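(* For all $z\in\mathbb{C}\setminus\{0\}$ with $|\arg z|<\pi$, $$W(z)=\frac{1}{\pi}\int_0^\pi\ln\left(1+z\,\frac{\sin v}{v}\,e^{v\cot v}\right)dv .$$
   Context: $W$ denotes the principal branch of the Lambert $W$ function: the unique holomorphic function on $\mathbb{C}\setminus(-\infty,-1/e]$ with $W(z)e^{W(z)}=z$ and $W(0)=0$. $\ln$ is the principal branch of the natural logarithm. $|\arg z|<\pi$ means $z\in\mathbb{C}\setminus(-\infty,0]$. *)

(* Defs.v *)
From Stdlib Require Import Reals.
From Coquelicot Require Import Coquelicot.
Open Scope R_scope.

Definition Cexp (z : C) : C := (exp (Re z) * cos (Im z), exp (Re z) * sin (Im z)).

(* Principal argument, with values in (-PI, PI] for z <> 0; [Carg 0] is a junk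
   value. *)
Definition Carg (z : C) : R :=
  if Rlt_dec (Im z) 0 then - acos (Re z / Cmod z) else acos (Re z / Cmod z).

(* Principal logarithm; junk value at 0. *)
Definition Cln (z : C) : C := (ln (Cmod z), Carg z).

(* The set C \ (-oo, -1/e]. *)
Definition LambertW_domain (z : C) : Prop :=
  ~ (Im z = 0 /\ Re z <= - (1 / exp 1)).

(* The conditions that determine the principal branch of the Lambert function
   on [LambertW_domain]; the values of W on the cut are left arbitrary. *)
Definition is_LambertW (W : C -> C) : Prop :=
  (forall z : C, LambertW_domain z ->
     @ex_derive C_AbsRing C_NormedModule W z) /\
  (forall z : C, LambertW_domain z -> (W z * Cexp (W z))%C = z) /\
  W (RtoC 0) = RtoC 0.

Definition cot (v : R) : R := cos v / sin v.

(* Since x / 0 = 0 in [R], the value at v = 0 is [Cln 1] instead of the limit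
   ln (1 + z e); [RInt] does not depend on endpoint values. *)
Definition LambertW_integrand (z : C) (v : R) : C :=
  Cln (RtoC 1 + z * RtoC (sin v / v * exp (v * cot v)))%C.

(* Main.v *)
Require Import Defs.
From Stdlib Require Import Reals Lra.
From Coquelicot Require Import Coquelicot.
Open Scope R_scope.

(** Write phi(v) = (sin v / v) e^(v cot v). On the curve
    gamma(v) = v cot v + i v = (v / sin v) e^(i v), -pi < v < pi, the quotient e^w / w is
    real and equals phi(v). The curve bounds the domain Omega of all w = x + i y with
    |y| < pi and x < y cot y. This domain is convex ([xcot_concave]), and w -> w e^(-w) is
    injective on it ([wexp_inj]).

    The point a = - W(z) satisfies a e^(-a) = - z and lies in Omega ([W_range]): the path
    t -> - W(t z) starts at 0, and it cannot reach gamma, where w e^(-w) = 1 / phi is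
    positive, because - t z is not positive. By injectivity a is the only zero of w + z e^w
    in Omega, so the residue theorem evaluates the integral of dw / (w + z e^w) around
    gamma as 2 pi i / (1 - a). On gamma the form is (dw / w) / (1 + z phi), and dw / w is
    i dv up to a term that is odd in v. Hence ([resolvent_integral])
      int_0^pi dv / (1 + z phi(v)) = pi / (1 + W(z)).
    Finally F(t) = int_0^pi ln(1 + t z phi(v)) dv has
      t F'(t) = int_0^pi (1 - 1 / (1 + t z phi(v))) dv = pi W(t z) / (1 + W(t z)),
    which is also t times the derivative of pi W(t z), by differentiation of
    W e^W = t z ([W_ray_ode]). Both functions vanish at t = 0, so they agree at t = 1.

    The residue theorem is obtained from one principle ([CInt_exact_family]): if the
    derivative of a family of forms in its parameter is exact along a closed contour, the
    integral does not depend on the parameter. Contracting the contour towards a by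
    w -> a + s (w - a) gives such a family; convexity and injectivity keep the contracted
    contour away from all zeros of w + z e^w, and the limit s -> 0 leaves
    dw / ((1 - a) (w - a)). Moving a to 0 along a segment is another such family and leaves
    dw / ((1 - a) w). As gamma is unbounded, the contour is gamma restricted to
    |v| <= V together with the vertical segment between its end points
    ([truncated_contour]); the segment contributes nothing in the limit V -> pi, where its
    abscissa V cot V tends to minus infinity. *)

(** * Calculus of complex-valued functions of real variables *)

(** The definitions of this part are componentwise, so that the theory of real-valued
    parametric integrals applies to each of the two parts. *)
Definition is_Cderive (f : R -> C) (x : R) (l : C) : Prop :=
  is_derive (fun t => Re (f t)) x (Re l) /\ is_derive (fun t => Im (f t)) x (Im l).

Definition Ccont (f : R -> C) (x : R) : Prop :=
  continuity_pt (fun t => Re (f t)) x /\ continuity_pt (fun t => Im (f t)) x.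

Definition Ccont2 (f : R -> R -> C) (x y : R) : Prop :=
  continuity_2d_pt (fun s v => Re (f s v)) x y /\
  continuity_2d_pt (fun s v => Im (f s v)) x y.

Definition CInt (f : R -> C) (a b : R) : C :=
  (RInt (fun t => Re (f t)) a b, RInt (fun t => Im (f t)) a b).

Lemma is_derive_value (f : R -> R) x l l' : is_derive f x l -> l = l' -> is_derive f x l'.
Proof. intros H <-; exact H. Qed.

Lemma is_derive_continuity_pt (f : R -> R) x l : is_derive f x l -> continuity_pt f x.
Proof.
  intros H. apply continuity_pt_filterlim, (@ex_derive_continuous R_AbsRing R_NormedModule).
  exists l; exact H.
Qed.

Lemma is_derive_Rmult (f g : R -> R) x l m :
  is_derive f x l -> is_derive g x m ->
  is_derive (fun t => f t * g t) x (l * g x + f x * m).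
Proof. intros Hf Hg. apply (is_derive_mult f g x l m Hf Hg Rmult_comm). Qed.

Lemma is_Cderive_ext_loc f g x l :
  locally x (fun t => f t = g t) -> is_Cderive f x l -> is_Cderive g x l.
Proof.
  intros E [H1 H2]; split.
  - apply is_derive_ext_loc with (2 := H1). revert E; apply filter_imp; intros t ->; reflexivity.
  - apply is_derive_ext_loc with (2 := H2). revert E; apply filter_imp; intros t ->; reflexivity.
Qed.

Lemma is_Cderive_unique f x l m : is_Cderive f x l -> is_Cderive f x m -> l = m.
Proof.
  intros [A1 A2] [B1 B2]. apply injective_projections.
  - change (Re l = Re m). rewrite <- (is_derive_unique _ _ _ A1). apply is_derive_unique, B1.
  - change (Im l = Im m). rewrite <- (is_derive_unique _ _ _ A2). apply is_derive_unique, B2.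
Qed.

Lemma is_Cderive_value f x l l' : is_Cderive f x l -> l = l' -> is_Cderive f x l'.
Proof. intros H <-; exact H. Qed.

Lemma is_Cderive_const c x : is_Cderive (fun _ => c) x (RtoC 0).
Proof. split; apply (@is_derive_const R_AbsRing R_NormedModule). Qed.

Lemma is_Cderive_RtoC (f : R -> R) (x l : R) : is_derive f x l -> is_Cderive (fun t => RtoC (f t)) x (RtoC l).
Proof.
  split; [exact H |].
  apply is_derive_ext with (fun _ => 0); [reflexivity |].
  apply (@is_derive_const R_AbsRing R_NormedModule).
Qed.

Lemma is_Cderive_id x : is_Cderive (fun s => RtoC s) x (RtoC 1).
Proof. apply is_Cderive_RtoC, (@is_derive_id R_AbsRing). Qed.

Lemma is_Cderive_plus f g x l m :
  is_Cderive f x l -> is_Cderive g x m -> is_Cderive (fun t => f t + g t)%C x (l + m)%C.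
Proof.
  intros [H1 H2] [H3 H4]; split.
  - apply (is_derive_plus (fun t => Re (f t)) (fun t => Re (g t))); assumption.
  - apply (is_derive_plus (fun t => Im (f t)) (fun t => Im (g t))); assumption.
Qed.

Lemma is_Cderive_opp f x l : is_Cderive f x l -> is_Cderive (fun t => - f t)%C x (- l)%C.
Proof.
  intros [H1 H2]; split.
  - apply (is_derive_opp (fun t => Re (f t))); assumption.
  - apply (is_derive_opp (fun t => Im (f t))); assumption.
Qed.

Lemma is_Cderive_minus f g x l m :
  is_Cderive f x l -> is_Cderive g x m -> is_Cderive (fun t => f t - g t)%C x (l - m)%C.
Proof. intros Hf Hg; apply is_Cderive_plus; [| apply is_Cderive_opp]; assumption. Qed.

Lemma is_Cderive_mult f g x l m :
  is_Cderive f x l -> is_Cderive g x m ->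
  is_Cderive (fun t => f t * g t)%C x (l * g x + f x * m)%C.
Proof.
  intros [H1 H2] [H3 H4]; split.
  - apply is_derive_value with
      ((Re l * Re (g x) + Re (f x) * Re m) - (Im l * Im (g x) + Im (f x) * Im m)).
    + apply (is_derive_minus (fun t => Re (f t) * Re (g t)) (fun t => Im (f t) * Im (g t)));
      apply is_derive_Rmult; assumption.
    + unfold Cmult, Cplus, Re, Im; simpl; ring.
  - apply is_derive_value with
      ((Re l * Im (g x) + Re (f x) * Im m) + (Im l * Re (g x) + Im (f x) * Re m)).
    + apply (is_derive_plus (fun t => Re (f t) * Im (g t)) (fun t => Im (f t) * Re (g t)));
      apply is_derive_Rmult; assumption.
    + unfold Cmult, Cplus, Re, Im; simpl; ring.
Qed.

Lemma Cnorm2_pos (z : C) : z <> RtoC 0 -> 0 < Re z ^ 2 + Im z ^ 2.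
Proof.
  intros H. destruct (Req_dec (Re z) 0) as [E1|E1].
  - destruct (Req_dec (Im z) 0) as [E2|E2].
    + exfalso; apply H; apply injective_projections; assumption.
    + generalize (pow2_gt_0 _ E2) (pow2_ge_0 (Re z)); lra.
  - generalize (pow2_gt_0 _ E1) (pow2_ge_0 (Im z)); lra.
Qed.

Lemma is_Cderive_inv f x l :
  is_Cderive f x l -> f x <> RtoC 0 ->
  is_Cderive (fun t => / f t)%C x (- (l / (f x * f x)))%C.
Proof.
  intros [H1 H2] H0. generalize (Cnorm2_pos _ H0); intros P.
  assert (D : is_derive (fun t => / (Re (f t) ^ 2 + Im (f t) ^ 2)) x
     (- (2 * Re (f x) * Re l + 2 * Im (f x) * Im l) / (Re (f x) ^ 2 + Im (f x) ^ 2) ^ 2)).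
  { apply (is_derive_inv (fun t => Re (f t) ^ 2 + Im (f t) ^ 2)); [| lra].
    apply (is_derive_plus (fun t => Re (f t) ^ 2) (fun t => Im (f t) ^ 2)).
    - eapply is_derive_value. apply (is_derive_pow (fun t => Re (f t)) 2 x _ H1). simpl; ring.
    - eapply is_derive_value. apply (is_derive_pow (fun t => Im (f t)) 2 x _ H2). simpl; ring. }
  revert D P H1 H2.
  split.
  - eapply is_derive_value.
    apply (is_derive_Rmult (fun t => Re (f t))); eassumption.
    unfold Cdiv, Cinv, Cmult, Copp, Re, Im in *; simpl in *. field.
    split; [| lra]. simpl in P.
    intros E; apply H0. 
    assert (fst (f x) * (fst (f x) * 1) + snd (f x) * (snd (f x) * 1) <> 0) by lra. nra.
  - apply is_derive_ext with (fun t => - Im (f t) * / (Re (f t) ^ 2 + Im (f t) ^ 2)).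
    { intros; reflexivity. }
    eapply is_derive_value.
    apply (is_derive_Rmult (fun t => - Im (f t))).
    apply (is_derive_opp (fun t => Im (f t))). eassumption. eassumption.
    unfold Cdiv, Cinv, Cmult, Copp, Re, Im, opp in *; simpl in *. field.
    split; [| lra]. nra.
Qed.

Lemma is_Cderive_exp f x l :
  is_Cderive f x l -> is_Cderive (fun t => Cexp (f t)) x (l * Cexp (f x))%C.
Proof.
  intros [H1 H2].
  assert (E : is_derive (fun t => exp (Re (f t))) x (Re l * exp (Re (f x)))).
  { apply (is_derive_comp exp (fun t => Re (f t))); [apply is_derive_exp | assumption]. }
  split.
  - eapply is_derive_value.
    apply (is_derive_Rmult (fun t => exp (Re (f t))) (fun t => cos (Im (f t)))).
    exact E. apply (is_derive_comp cos (fun t => Im (f t))); [apply is_derive_cos | exact H2].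
    unfold Cexp, Cmult, scal, Re, Im; simpl; unfold mult; simpl; ring.
  - eapply is_derive_value.
    apply (is_derive_Rmult (fun t => exp (Re (f t))) (fun t => sin (Im (f t)))).
    exact E. apply (is_derive_comp sin (fun t => Im (f t))); [apply is_derive_sin | exact H2].
    unfold Cexp, Cmult, scal, Re, Im; simpl; unfold mult; simpl; ring.
Qed.

Lemma is_Cderive_cont f x l : is_Cderive f x l -> Ccont f x.
Proof.
  intros [H1 H2]; split; eapply is_derive_continuity_pt; eassumption.
Qed.

Lemma Ccont2_const c x y : Ccont2 (fun _ _ => c) x y.
Proof. split; apply continuity_2d_pt_const. Qed.

Lemma Ccont2_snd f x y : Ccont f y -> Ccont2 (fun _ v => f v) x y.
Proof.
  intros [H1 H2]; split.
  - apply (continuity_1d_2d_pt_comp (fun t => Re (f t)) (fun _ v => v)); [assumption | apply continuity_2d_pt_id2].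
  - apply (continuity_1d_2d_pt_comp (fun t => Im (f t)) (fun _ v => v)); [assumption | apply continuity_2d_pt_id2].
Qed.

Lemma Ccont2_fst x y : Ccont2 (fun s _ => RtoC s) x y.
Proof. split; [apply continuity_2d_pt_id1 | apply (continuity_2d_pt_const x y 0)]. Qed.

Lemma Ccont2_plus f g x y :
  Ccont2 f x y -> Ccont2 g x y -> Ccont2 (fun s v => f s v + g s v)%C x y.
Proof.
  intros [H1 H2] [H3 H4]; split; simpl.
  - apply (continuity_2d_pt_plus (fun s v => Re (f s v)) (fun s v => Re (g s v))); assumption.
  - apply (continuity_2d_pt_plus (fun s v => Im (f s v)) (fun s v => Im (g s v))); assumption.
Qed.

Lemma Ccont2_opp f x y : Ccont2 f x y -> Ccont2 (fun s v => - f s v)%C x y.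
Proof.
  intros [H1 H2]; split; simpl.
  - apply (continuity_2d_pt_opp (fun s v => Re (f s v))); assumption.
  - apply (continuity_2d_pt_opp (fun s v => Im (f s v))); assumption.
Qed.

Lemma Ccont2_minus f g x y :
  Ccont2 f x y -> Ccont2 g x y -> Ccont2 (fun s v => f s v - g s v)%C x y.
Proof. intros; apply Ccont2_plus; [| apply Ccont2_opp]; assumption. Qed.

Lemma Ccont2_mult f g x y :
  Ccont2 f x y -> Ccont2 g x y -> Ccont2 (fun s v => f s v * g s v)%C x y.
Proof.
  intros [H1 H2] [H3 H4]; split; simpl.
  - apply (continuity_2d_pt_minus (fun s v => Re (f s v) * Re (g s v)) (fun s v => Im (f s v) * Im (g s v)));
    apply continuity_2d_pt_mult; assumption.
  - apply (continuity_2d_pt_plus (fun s v => Re (f s v) * Im (g s v)) (fun s v => Im (f s v) * Re (g s v)));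
    apply continuity_2d_pt_mult; assumption.
Qed.

Lemma Ccont2_norm2 f x y :
  Ccont2 f x y -> continuity_2d_pt (fun s v => Re (f s v) ^ 2 + Im (f s v) ^ 2) x y.
Proof.
  intros [H1 H2].
  apply continuity_2d_pt_ext with
    (fun s v => Re (f s v) * Re (f s v) + Im (f s v) * Im (f s v)).
  { intros; ring. }
  apply continuity_2d_pt_plus; apply continuity_2d_pt_mult; assumption.
Qed.

Lemma Ccont2_inv f x y :
  Ccont2 f x y -> f x y <> RtoC 0 -> Ccont2 (fun s v => / f s v)%C x y.
Proof.
  intros H H0.
  assert (D : continuity_2d_pt (fun s v => / (Re (f s v) ^ 2 + Im (f s v) ^ 2)) x y).
  { apply continuity_2d_pt_inv; [apply Ccont2_norm2, H |].
    generalize (Cnorm2_pos _ H0); lra. }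
  destruct H as [H1 H2]; split; simpl.
  - apply (continuity_2d_pt_mult (fun s v => Re (f s v))); assumption.
  - apply (continuity_2d_pt_mult (fun s v => - Im (f s v))); [| assumption].
    apply continuity_2d_pt_opp; assumption.
Qed.

Lemma Ccont2_exp f x y : Ccont2 f x y -> Ccont2 (fun s v => Cexp (f s v)) x y.
Proof.
  intros [H1 H2].
  assert (E : continuity_2d_pt (fun s v => exp (Re (f s v))) x y).
  { apply (continuity_1d_2d_pt_comp exp); [| assumption].
    apply derivable_continuous_pt, derivable_pt_exp. }
  split; simpl.
  - apply (continuity_2d_pt_mult (fun s v => exp (Re (f s v))) (fun s v => cos (Im (f s v)))); [assumption|].
    apply (continuity_1d_2d_pt_comp cos); [apply continuity_cos | assumption].
  - apply (continuity_2d_pt_mult (fun s v => exp (Re (f s v))) (fun s v => sin (Im (f s v)))); [assumption|].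
    apply (continuity_1d_2d_pt_comp sin); [apply continuity_sin | assumption].
Qed.

Lemma Ccont2_neq0 f x y :
  Ccont2 f x y -> f x y <> RtoC 0 -> locally_2d (fun s v => f s v <> RtoC 0) x y.
Proof.
  intros H H0.
  destruct (continuity_2d_pt_neq_0 _ _ _ (Ccont2_norm2 _ _ _ H)) as [d Hd].
  { generalize (Cnorm2_pos _ H0); lra. }
  exists d; intros u v Hu Hv E. apply (Hd u v Hu Hv). rewrite E; simpl; ring.
Qed.

Lemma continuity_2d_slice (f : R -> R -> R) x y :
  continuity_2d_pt f x y -> continuity_pt (f x) y.
Proof.
  intros H. apply continuity_pt_locally. intros eps. destruct (H eps) as [d Hd].
  exists d; intros v Hv. apply Hd; [| exact Hv].
  rewrite Rminus_eq_0, Rabs_R0; apply d.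
Qed.

Lemma Ccont2_slice f x y : Ccont2 f x y -> Ccont (f x) y.
Proof.
  intros [H1 H2]; split;
  [apply (continuity_2d_slice _ _ _ H1) | apply (continuity_2d_slice _ _ _ H2)].
Qed.

Lemma Ccont_minus f g v : Ccont f v -> Ccont g v -> Ccont (fun v => f v - g v)%C v.
Proof.
  intros Hf Hg. apply (Ccont2_slice (fun _ v => f v - g v)%C 0 v).
  apply Ccont2_minus; apply Ccont2_snd; assumption.
Qed.

Lemma Ccont_ext f g x : (forall t, f t = g t) -> Ccont f x -> Ccont g x.
Proof.
  intros E [H1 H2]; split.
  - apply (continuity_pt_ext (fun t => Re (f t))); [| exact H1]. intros t; rewrite E; reflexivity.
  - apply (continuity_pt_ext (fun t => Im (f t))); [| exact H2]. intros t; rewrite E; reflexivity.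
Qed.

(** * Integrals depending on a parameter, and exact families of forms *)

Lemma Ccont_ex_RInt f al be :
  al <= be -> (forall v, al <= v <= be -> Ccont f v) ->
  ex_RInt (fun v => Re (f v)) al be /\ ex_RInt (fun v => Im (f v)) al be.
Proof.
  intros Hab H; split; apply (@ex_RInt_continuous R_CompleteNormedModule);
  rewrite Rmin_left, Rmax_right by lra; intros v Hv; apply continuity_pt_filterlim, H, Hv.
Qed.

Lemma CInt_ext f g al be :
  al <= be -> (forall v, al < v < be -> f v = g v) -> CInt f al be = CInt g al be.
Proof.
  intros Hab H. unfold CInt; f_equal; apply RInt_ext;
  rewrite Rmin_left, Rmax_right by lra; intros v Hv; rewrite H; auto.
Qed.

Lemma CInt_minus f g al be :
  al <= be -> (forall v, al <= v <= be -> Ccont f v) ->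
  (forall v, al <= v <= be -> Ccont g v) ->
  CInt (fun v => f v - g v)%C al be = (CInt f al be - CInt g al be)%C.
Proof.
  intros Hab Hf Hg. destruct (Ccont_ex_RInt f al be Hab Hf) as [F1 F2].
  destruct (Ccont_ex_RInt g al be Hab Hg) as [G1 G2].
  apply injective_projections; simpl.
  - apply (@RInt_minus R_CompleteNormedModule (fun v => Re (f v)) (fun v => Re (g v))); assumption.
  - apply (@RInt_minus R_CompleteNormedModule (fun v => Im (f v)) (fun v => Im (g v))); assumption.
Qed.

Lemma CInt_scal k f al be :
  al <= be -> (forall v, al <= v <= be -> Ccont f v) ->
  CInt (fun v => k * f v)%C al be = (k * CInt f al be)%C.
Proof.
  intros Hab Hf. destruct (Ccont_ex_RInt f al be Hab Hf) as [F1 F2].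
  assert (S : forall h c, ex_RInt h al be ->
    ex_RInt (fun v => c * h v) al be /\ RInt (fun v => c * h v) al be = c * RInt h al be).
  { intros h c Hh; split; [apply (@ex_RInt_scal R_NormedModule h) | apply (@RInt_scal R_CompleteNormedModule h)]; exact Hh. }
  apply injective_projections; simpl.
  - rewrite <- (proj2 (S _ _ F1)), <- (proj2 (S _ _ F2)).
    apply (@RInt_minus R_CompleteNormedModule (fun v => fst k * Re (f v)) (fun v => snd k * Im (f v)));
    apply S; assumption.
  - rewrite <- (proj2 (S _ _ F1)), <- (proj2 (S _ _ F2)).
    apply (@RInt_plus R_CompleteNormedModule (fun v => fst k * Im (f v)) (fun v => snd k * Re (f v)));
    apply S; assumption.
Qed.

Lemma CInt_Chasles f a b c :
  a <= b -> b <= c -> (forall v, a <= v <= c -> Ccont f v) ->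
  CInt f a c = (CInt f a b + CInt f b c)%C.
Proof.
  intros Hab Hbc Hf.
  destruct (Ccont_ex_RInt f a b Hab ltac:(intros; apply Hf; lra)) as [A1 A2].
  destruct (Ccont_ex_RInt f b c Hbc ltac:(intros; apply Hf; lra)) as [B1 B2].
  apply injective_projections; simpl; symmetry;
  [apply (@RInt_Chasles R_CompleteNormedModule (fun v => Re (f v)))
  | apply (@RInt_Chasles R_CompleteNormedModule (fun v => Im (f v)))]; assumption.
Qed.

Lemma CInt_const k al be : CInt (fun _ => k) al be = (RtoC (be - al) * k)%C.
Proof.
  apply injective_projections; simpl;
  rewrite RInt_const; unfold scal; simpl; unfold mult; simpl; unfold Re, Im; ring.
Qed.

Lemma im_le_Cmod z : Rabs (Im z) <= Cmod z.
Proof. eapply Rle_trans; [apply Rmax_r | apply Rmax_Cmod]. Qed.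

Lemma Cmod_le_of_parts z M : Rabs (Re z) <= M -> Rabs (Im z) <= M -> Cmod z <= 2 * M.
Proof.
  intros H1 H2. eapply Rle_trans; [apply Cmod_2Rmax |].
  assert (S2 : sqrt 2 <= 2) by (rewrite <- (sqrt_pow2 2) at 2 by lra; apply sqrt_le_1; lra).
  apply Rmult_le_compat; [apply sqrt_pos | | exact S2 | apply Rmax_lub; assumption].
  eapply Rle_trans; [apply Rabs_pos | apply Rmax_l].
Qed.

Lemma CInt_bound f al be M :
  al <= be -> (forall v, al <= v <= be -> Ccont f v) ->
  (forall v, al <= v <= be -> Cmod (f v) <= M) ->
  Cmod (CInt f al be) <= 2 * (be - al) * M.
Proof.
  intros Hab Hf HM. destruct (Ccont_ex_RInt f al be Hab Hf) as [F1 F2].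
  assert (A : Rabs (RInt (fun v => Re (f v)) al be) <= (be - al) * M).
  { apply abs_RInt_le_const; auto. intros v Hv. eapply Rle_trans; [apply re_le_Cmod | auto]. }
  assert (B : Rabs (RInt (fun v => Im (f v)) al be) <= (be - al) * M).
  { apply abs_RInt_le_const; auto. intros v Hv.
    eapply Rle_trans; [apply im_le_Cmod | auto]. }
  rewrite Rmult_assoc. apply Cmod_le_of_parts; assumption.
Qed.

Lemma Ceq0_of_small x : (forall eps, 0 < eps -> Cmod x <= eps) -> x = RtoC 0.
Proof.
  intros H. apply Cmod_eq_0. destruct (Cmod_ge_0 x) as [P|P]; [| auto].
  generalize (H (Cmod x / 2) ltac:(lra)). lra.
Qed.

(** Odd terms of an integrand over a symmetric interval disappear in this form. *)
Lemma CInt_symmetric f V :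
  0 <= V -> (forall v, - V <= v <= V -> Ccont f v) ->
  CInt f (- V) V = CInt (fun v => f v + f (- v)%R)%C 0 V.
Proof.
  intros HV Hf.
  assert (G : forall h, (forall v, - V <= v <= V -> continuity_pt h v) ->
    RInt h (- V) V = RInt (fun v => h v + h (- v)) 0 V).
  { intros h Hh.
    assert (X : forall al be, - V <= al -> al <= be -> be <= V -> ex_RInt h al be).
    { intros al be H1 H2 H3. apply (@ex_RInt_continuous R_CompleteNormedModule).
      rewrite Rmin_left, Rmax_right by lra. intros v Hv. apply continuity_pt_filterlim, Hh. lra. }
    assert (I : is_RInt (fun v => h (- v)) 0 V (RInt h (- V) 0)).
    { apply is_RInt_ext with (fun v => - (- h (- v))).
      - intros v _. apply (Ropp_involutive (h (- v))).
      - replace (RInt h (- V) 0) with (- RInt h 0 (- V)).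
        + apply (@is_RInt_opp R_NormedModule (fun v => - h (- v))).
          apply (@is_RInt_comp_opp R_NormedModule h).
          rewrite Ropp_0. apply (@RInt_correct R_CompleteNormedModule).
          apply (@ex_RInt_swap R_NormedModule), X; lra.
        + apply (@opp_RInt_swap R_CompleteNormedModule). apply (@ex_RInt_swap R_NormedModule), X; lra. }
    rewrite <- (@RInt_Chasles R_CompleteNormedModule h (- V) 0 V) by (apply X; lra).
    rewrite (@RInt_plus R_CompleteNormedModule h (fun v => h (- v))).
    - rewrite (is_RInt_unique (fun v => h (- v)) 0 V _ I). unfold plus; simpl. ring.
    - apply X; lra.
    - eexists; exact I. }
  apply injective_projections; simpl; apply G; intros; apply Hf; assumption.
Qed.

Lemma Ccont_bounded f al be :
  al <= be -> (forall v, al <= v <= be -> Ccont f v) ->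
  exists B, 0 < B /\ forall v, al <= v <= be -> Cmod (f v) <= B.
Proof.
  intros Hab Hf.
  destruct (continuity_ab_maj (fun v => Re (f v) ^ 2 + Im (f v) ^ 2) al be Hab) as [m [Hm _]].
  { intros v Hv. apply continuity_pt_plus.
    - apply (continuity_pt_comp (fun v => Re (f v)) (fun x => x ^ 2)); [apply Hf, Hv |].
      apply derivable_continuous_pt, derivable_pt_pow.
    - apply (continuity_pt_comp (fun v => Im (f v)) (fun x => x ^ 2)); [apply Hf, Hv |].
      apply derivable_continuous_pt, derivable_pt_pow. }
  exists (Re (f m) ^ 2 + Im (f m) ^ 2 + 1). split.
  - generalize (pow2_ge_0 (Re (f m))) (pow2_ge_0 (Im (f m))). lra.
  - intros v Hv. generalize (Hm v Hv) (Cmod2_alt (f v)) (pow2_ge_0 (Cmod (f v) - 1)). cbv beta. nra.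
Qed.

(** Freezing the parameter outside [lo, hi] turns hypotheses on the closed interval into
    two-sided continuity at its end points, as the mean value theorem requires. *)
Definition clamp (lo hi s : R) : R := Rmax lo (Rmin hi s).

Lemma clamp_range lo hi s : lo <= hi -> lo <= clamp lo hi s <= hi.
Proof.
  intros H; unfold clamp; split; [apply Rmax_l |].
  apply Rmax_lub; [exact H | apply Rmin_l].
Qed.

Lemma clamp_id lo hi s : lo <= s <= hi -> clamp lo hi s = s.
Proof. intros [H1 H2]; unfold clamp. rewrite Rmin_right by lra. apply Rmax_right; lra. Qed.

Lemma clamp_lipschitz lo hi s t : Rabs (clamp lo hi s - clamp lo hi t) <= Rabs (s - t).
Proof.
  unfold clamp, Rmax, Rmin.
  repeat destruct Rle_dec; unfold Rabs; repeat destruct Rcase_abs; lra.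
Qed.

Lemma ex_RInt_slice (f : R -> R -> R) s al be :
  al <= be -> (forall v, al <= v <= be -> continuity_2d_pt f s v) ->
  ex_RInt (f s) al be.
Proof.
  intros Hab H. apply (@ex_RInt_continuous R_CompleteNormedModule).
  rewrite Rmin_left, Rmax_right by lra. intros v Hv.
  apply continuity_pt_filterlim, continuity_2d_slice, H, Hv.
Qed.

(** Joint continuity on the compact interval of integration is uniform in the integration
    variable. *)
Lemma RInt_param_cont (f : R -> R -> R) s0 al be :
  al <= be ->
  (forall s v, al <= v <= be -> continuity_2d_pt f s v) ->
  continuity_pt (fun s => RInt (f s) al be) s0.
Proof.
  intros Hab H. apply continuity_pt_locally. intros eps.
  assert (P : 0 < eps / (2 * (be - al + 1))).
  { apply Rdiv_lt_0_compat; [apply eps | lra]. }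
  destruct (uniform_continuity_2d_1d' f al be s0 (fun v Hv => H s0 v Hv) (mkposreal _ P)) as [d Hd].
  exists d; intros s Hs. simpl in Hd.
  rewrite <- (@RInt_minus R_CompleteNormedModule); try (apply ex_RInt_slice; auto).
  eapply Rle_lt_trans.
  - apply abs_RInt_le_const with (M := eps / (2 * (be - al + 1))); [assumption | |].
    + apply (@ex_RInt_minus R_NormedModule); apply ex_RInt_slice; auto.
    + intros v Hv. unfold minus, plus, opp; simpl. left.
      change (Rabs (s - s0) < d) in Hs. apply Rabs_def2 in Hs. generalize (cond_pos d); intros.
      apply Hd; try lra. rewrite Rminus_eq_0, Rabs_R0. apply d.
  - destruct eps as [e He]; simpl in *.
    replace ((be - al) * (e / (2 * (be - al + 1)))) with (e * ((be - al) / (2 * (be - al + 1)))) by (field; lra).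
    rewrite <- (Rmult_1_r e) at 2. apply Rmult_lt_compat_l; [assumption |].
    apply Rmult_lt_reg_r with (2 * (be - al + 1)); [lra |].
    unfold Rdiv; rewrite Rmult_assoc, Rinv_l; lra.
Qed.

Lemma continuity_2d_clamp (f : R -> R -> R) lo hi s v :
  continuity_2d_pt f (clamp lo hi s) v ->
  continuity_2d_pt (fun u w => f (clamp lo hi u) w) s v.
Proof.
  intros H eps. destruct (H eps) as [d Hd]. exists d; intros u w Hu Hw.
  apply Hd; [| assumption]. eapply Rle_lt_trans; [apply clamp_lipschitz | assumption].
Qed.

Lemma clamp_near lo hi s : lo < s < hi -> locally s (fun u => lo < u < hi).
Proof.
  intros H. assert (P : 0 < Rmin (s - lo) (hi - s)) by (apply Rmin_pos; lra).
  exists (mkposreal _ P). intros u Hu. change (Rabs (u - s) < Rmin (s - lo) (hi - s)) in Hu.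
  apply Rabs_def2 in Hu. generalize (Rmin_l (s - lo) (hi - s)) (Rmin_r (s - lo) (hi - s)). lra.
Qed.

Lemma RInt_param_derive (f d : R -> R -> R) lo hi al be s :
  al <= be -> lo < s < hi ->
  (forall s v, lo <= s <= hi -> al <= v <= be -> continuity_2d_pt f s v) ->
  (forall s v, lo < s < hi -> al <= v <= be ->
     locally_2d (fun u w => is_derive (fun t => f t w) u (d u w)) s v) ->
  (forall v, al <= v <= be -> continuity_2d_pt d s v) ->
  is_derive (fun u => RInt (f (clamp lo hi u)) al be) s (RInt (d s) al be).
Proof.
  intros Hab Hs Hf Hd Hdc.
  assert (E : forall u w, lo < u < hi ->
    is_derive (fun t => f t w) u (d u w) -> is_derive (fun t => f (clamp lo hi t) w) u (d u w)).
  { intros u w Hu D. apply is_derive_ext_loc with (2 := D).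
    generalize (clamp_near lo hi u Hu). apply filter_imp. intros t Ht.
    rewrite clamp_id by lra. reflexivity. }
  assert (D0 : forall u w, lo < u < hi -> al <= w <= be -> is_derive (fun t => f t w) u (d u w)).
  { intros u w Hu Hw. destruct (Hd u w Hu Hw) as [e He]. apply He;
    rewrite Rminus_eq_0, Rabs_R0; apply e. }
  eapply is_derive_value.
  - apply (is_derive_RInt_param (fun u w => f (clamp lo hi u) w) al be s);
    rewrite ?Rmin_left, ?Rmax_right by lra.
    + generalize (clamp_near lo hi s Hs). apply filter_imp. intros u Hu w Hw.
      exists (d u w). apply E; auto.
    + intros v Hv. apply continuity_2d_pt_ext_loc with (2 := Hdc v Hv).
      destruct (Hd s v Hs Hv) as [e1 He1]. destruct (clamp_near lo hi s Hs) as [e2 He2].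
      assert (P : 0 < Rmin e1 e2) by (apply Rmin_pos; apply cond_pos).
      exists (mkposreal _ P); simpl; intros u w Hu Hw.
      symmetry. apply is_derive_unique, E.
      * apply He2. apply Rlt_le_trans with (1 := Hu), Rmin_r.
      * apply He1; [apply Rlt_le_trans with (1 := Hu) | apply Rlt_le_trans with (1 := Hw)]; apply Rmin_l.
    + apply filter_forall. intros u. apply (ex_RInt_slice (fun u w => f (clamp lo hi u) w)); [assumption|].
      intros v Hv. apply continuity_2d_clamp, Hf; [apply clamp_range; lra | assumption].
  - apply RInt_ext. rewrite Rmin_left, Rmax_right by lra. intros v Hv.
    apply is_derive_unique, E; [assumption |]. apply D0; lra.
Qed.

Lemma RInt_param_clamp_cont (f : R -> R -> R) lo hi al be s :
  al <= be -> lo <= hi ->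
  (forall s v, lo <= s <= hi -> al <= v <= be -> continuity_2d_pt f s v) ->
  continuity_pt (fun u => RInt (f (clamp lo hi u)) al be) s.
Proof.
  intros Hab Hl Hf.
  apply (RInt_param_cont (fun u w => f (clamp lo hi u) w)); [assumption|].
  intros u v Hv. apply continuity_2d_clamp, Hf; [apply clamp_range; assumption | assumption].
Qed.

Lemma eq_of_derive_zero (h : R -> R) lo hi :
  lo <= hi -> (forall s, lo < s < hi -> is_derive h s 0) ->
  (forall s, lo <= s <= hi -> continuity_pt h s) -> h lo = h hi.
Proof.
  intros Hl D Hc. destruct (MVT_gen h lo hi (fun _ => 0)) as [c [_ E]].
  - rewrite Rmin_left, Rmax_right by lra. exact D.
  - rewrite Rmin_left, Rmax_right by lra. exact Hc.
  - lra.
Qed.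

Lemma locally_2d_conj (P Q : R -> R -> Prop) s v :
  locally_2d (fun u w => P u w /\ Q u w) s v -> locally_2d P s v /\ locally_2d Q s v.
Proof. intros [e He]; split; exists e; intros u w Hu Hw; apply (He u w Hu Hw). Qed.

Lemma CInt_param_derive (K D : R -> R -> C) lo hi al be s :
  al <= be -> lo < s < hi ->
  (forall s v, lo <= s <= hi -> al <= v <= be -> Ccont2 K s v) ->
  (forall s v, lo < s < hi -> al <= v <= be ->
     locally_2d (fun u w => is_Cderive (fun t => K t w) u (D u w)) s v) ->
  (forall v, al <= v <= be -> Ccont2 D s v) ->
  is_Cderive (fun u => CInt (K (clamp lo hi u)) al be) s (CInt (D s) al be).
Proof.
  intros Hab Hs HK HD HDc. split.
  - apply (RInt_param_derive (fun u w => Re (K u w)) (fun u w => Re (D u w))); try assumption.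
    + intros; apply HK; assumption.
    + intros; apply (locally_2d_conj _ _ _ _ (HD _ _ H H0)).
    + intros; apply HDc; assumption.
  - apply (RInt_param_derive (fun u w => Im (K u w)) (fun u w => Im (D u w))); try assumption.
    + intros; apply HK; assumption.
    + intros; apply (locally_2d_conj _ _ _ _ (HD _ _ H H0)).
    + intros; apply HDc; assumption.
Qed.

Lemma CInt_param_clamp_cont (K : R -> R -> C) lo hi al be s :
  al <= be -> lo <= hi ->
  (forall s v, lo <= s <= hi -> al <= v <= be -> Ccont2 K s v) ->
  Ccont (fun u => CInt (K (clamp lo hi u)) al be) s.
Proof.
  intros Hab Hl HK. split.
  - apply (RInt_param_clamp_cont (fun u w => Re (K u w))); try assumption.
    intros; apply HK; assumption.
  - apply (RInt_param_clamp_cont (fun u w => Im (K u w))); try assumption.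
    intros; apply HK; assumption.
Qed.

Lemma Ceq_of_derive_zero (h : R -> C) lo hi :
  lo <= hi -> (forall s, lo < s < hi -> is_Cderive h s (RtoC 0)) ->
  (forall s, lo <= s <= hi -> Ccont h s) -> h lo = h hi.
Proof.
  intros Hl D Hc. apply injective_projections.
  - apply (eq_of_derive_zero (fun t => Re (h t))); [assumption | |]; intros; [apply D | apply Hc]; assumption.
  - apply (eq_of_derive_zero (fun t => Im (h t))); [assumption | |]; intros; [apply D | apply Hc]; assumption.
Qed.

Lemma CInt_derive (M D : R -> C) al be :
  al <= be -> (forall v, al <= v <= be -> is_Cderive M v (D v)) ->
  (forall v, al <= v <= be -> Ccont D v) ->
  CInt D al be = (M be - M al)%C.
Proof.
  intros Hab HM HD. apply injective_projections; simpl.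
  - apply is_RInt_unique. apply (@is_RInt_derive R_CompleteNormedModule (fun t => Re (M t)));
    rewrite Rmin_left, Rmax_right by lra; intros v Hv; [apply HM, Hv | apply continuity_pt_filterlim, HD, Hv].
  - apply is_RInt_unique. apply (@is_RInt_derive R_CompleteNormedModule (fun t => Im (M t)));
    rewrite Rmin_left, Rmax_right by lra; intros v Hv; [apply HM, Hv | apply continuity_pt_filterlim, HD, Hv].
Qed.

(** The substitute for Cauchy's theorem. The parameter derivative of K s is
    the derivative of M s along the contour, so it integrates to the difference of the
    end values of M s, which is zero when the contour is closed. *)
Lemma CInt_exact_family (K D M : R -> R -> C) lo hi al be :
  al <= be -> lo <= hi ->
  (forall s v, lo <= s <= hi -> al <= v <= be -> Ccont2 K s v) ->
  (forall s v, lo < s < hi -> al <= v <= be ->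
     locally_2d (fun u w => is_Cderive (fun t => K t w) u (D u w)) s v) ->
  (forall s v, lo < s < hi -> al <= v <= be -> Ccont2 D s v) ->
  (forall s v, lo < s < hi -> al <= v <= be -> is_Cderive (M s) v (D s v)) ->
  (forall s, lo < s < hi -> M s be = M s al) ->
  CInt (K lo) al be = CInt (K hi) al be.
Proof.
  intros Hab Hl HK HD HDc HM Hb.
  generalize (Ceq_of_derive_zero (fun u => CInt (K (clamp lo hi u)) al be) lo hi Hl); intros E.
  rewrite !clamp_id in E by lra. apply E.
  - intros s Hs. eapply is_Cderive_value.
    + apply CInt_param_derive with (D := D); auto.
    + rewrite (CInt_derive (M s)); auto.
      * rewrite Hb by assumption. ring.
      * intros v Hv. apply Ccont2_slice. auto.
  - intros; apply CInt_param_clamp_cont; assumption.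
Qed.

(** * The function v cot v *)

(** The power series removes the singularity of sin y / y at 0; the curve has to be
    continuously differentiable there. *)
Definition sinc (y : R) : R := PSeries sin_n (y * y).
Definition dsinc (y : R) : R := PSeries (PS_derive sin_n) (y * y) * (2 * y).

Lemma sin_eq_sinc y : sin y = y * sinc y.
Proof.
  unfold sin. destruct (exist_sin (Rsqr y)) as [l Hl].
  apply (f_equal (fun u => y * u)). unfold sinc, PSeries. symmetry. apply is_series_unique.
  apply is_series_Reals in Hl. apply is_series_ext with (2 := Hl). intros n; reflexivity.
Qed.

Lemma sinc_radius : CV_radius sin_n = p_infty.
Proof.
  apply CV_radius_infinite_DAlembert.
  - intros n. unfold sin_n. apply Rmult_integral_contrapositive. split.
    + apply pow_nonzero; lra.
    + apply Rinv_neq_0_compat, INR_fact_neq_0.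
  - apply is_lim_seq_Reals, Alembert_sin.
Qed.

Lemma sinc_derive y : is_derive sinc y (dsinc y).
Proof.
  unfold sinc. eapply is_derive_value.
  - apply (is_derive_comp (PSeries sin_n) (fun y => y * y)).
    + apply is_derive_PSeries. rewrite sinc_radius. exact I.
    + apply is_derive_Rmult; apply (@is_derive_id R_AbsRing).
  - unfold dsinc, scal, one; simpl; unfold mult; simpl; ring.
Qed.

Lemma dsinc_cont y : continuity_pt dsinc y.
Proof.
  apply continuity_pt_filterlim, (@ex_derive_continuous R_AbsRing R_NormedModule).
  unfold dsinc. apply ex_derive_mult.
  - apply (ex_derive_comp (PSeries (PS_derive sin_n)) (fun y => y * y)).
    + apply ex_derive_PSeries. rewrite CV_radius_derive, sinc_radius. exact I.
    + apply (ex_derive_mult (fun y => y) (fun y => y)); apply (@ex_derive_id R_AbsRing).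
  - apply (ex_derive_mult (fun y => 2) (fun y => y)); [apply (@ex_derive_const R_AbsRing R_NormedModule) | apply (@ex_derive_id R_AbsRing)].
Qed.

Lemma sinc_even y : sinc (- y) = sinc y.
Proof. unfold sinc; f_equal; ring. Qed.

Lemma dsinc_odd y : dsinc (- y) = - dsinc y.
Proof. unfold dsinc. replace (- y * - y) with (y * y) by ring. ring. Qed.

(** Differentiation of sin y = y sinc y in two ways. *)
Lemma dsinc_eq y : y * dsinc y = cos y - sinc y.
Proof.
  assert (D1 : is_derive sin y (1 * sinc y + y * dsinc y)).
  { apply is_derive_ext with (fun y => y * sinc y).
    - intros t; symmetry; apply sin_eq_sinc.
    - apply is_derive_Rmult; [apply (@is_derive_id R_AbsRing) | apply sinc_derive]. }
  generalize (is_derive_unique _ _ _ D1) (is_derive_unique _ _ _ (is_derive_sin y)). lra.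
Qed.

Lemma sinc_0 : sinc 0 = 1.
Proof. generalize (dsinc_eq 0). rewrite cos_0. lra. Qed.

Lemma sinc_cont y : continuity_pt sinc y.
Proof.  eapply is_derive_continuity_pt, sinc_derive.
Qed.

Lemma sinc_pos y : Rabs y < PI -> 0 < sinc y.
Proof.
  assert (P : forall u, 0 < u < PI -> 0 < sinc u).
  { intros u Hu. apply Rmult_lt_reg_l with u; [lra |].
    rewrite <- sin_eq_sinc, Rmult_0_r. apply sin_gt_0; lra. }
  intros H; apply Rabs_def2 in H. destruct (Rtotal_order y 0) as [L|[->|L]].
  - rewrite <- sinc_even. apply P; lra.
  - rewrite sinc_0; lra.
  - apply P; lra.
Qed.

Lemma sinc_at_PI y : Rabs y = PI -> sinc y = 0 /\ cos y = - 1.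
Proof.
  intros L. generalize (sin_eq_sinc y) PI_RGT_0. unfold Rabs in L. destruct Rcase_abs.
  - replace y with (- PI) by lra. rewrite sin_neg, sin_PI, cos_neg, cos_PI. split; [nra | reflexivity].
  - rewrite L, sin_PI, cos_PI. split; [nra | reflexivity].
Qed.

(** The smooth extension of y cot y through y = 0. *)
Definition xcot (y : R) : R := cos y / sinc y.
Definition dxcot (y : R) : R := (- sin y * sinc y - cos y * dsinc y) / (sinc y) ^ 2.

Lemma xcot_derive y : Rabs y < PI -> is_derive xcot y (dxcot y).
Proof.
  intros H. generalize (sinc_pos y H); intros P.
  apply (is_derive_div cos sinc); [apply is_derive_cos | apply sinc_derive | lra].
Qed.

Lemma xcot_cont y : Rabs y < PI -> continuity_pt xcot y.
Proof. intros H. eapply is_derive_continuity_pt, xcot_derive, H. Qed.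

Lemma dxcot_cont y : Rabs y < PI -> continuity_pt dxcot y.
Proof.
  intros H. generalize (sinc_pos y H); intros P.
  unfold dxcot. apply continuity_pt_div.
  - apply continuity_pt_minus.
    + apply continuity_pt_mult; [apply continuity_pt_opp, continuity_sin | apply sinc_cont].
    + apply continuity_pt_mult; [apply continuity_cos | apply dsinc_cont].
  - apply (continuity_pt_comp sinc (fun x => x ^ 2)); [apply sinc_cont |].
    apply derivable_continuous_pt, derivable_pt_pow.
  - apply pow_nonzero; lra.
Qed.

Lemma xcot_even y : xcot (- y) = xcot y.
Proof. unfold xcot. rewrite cos_neg, sinc_even. reflexivity. Qed.

Lemma dxcot_odd y : dxcot (- y) = - dxcot y.
Proof. unfold dxcot. rewrite cos_neg, sin_neg, sinc_even, dsinc_odd. unfold Rdiv; ring. Qed.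

Lemma dxcot_closed y : 0 < y < PI -> dxcot y = (sin y * cos y - y) / (sin y) ^ 2.
Proof.
  intros H. assert (P : 0 < sinc y) by (apply sinc_pos, Rabs_def1; lra).
  assert (E : y ^ 2 * sinc y ^ 2 + cos y ^ 2 = 1).
  { generalize (sin2_cos2 y); unfold Rsqr; rewrite (sin_eq_sinc y); intros <-; ring. }
  unfold dxcot. rewrite (sin_eq_sinc y).
  replace (dsinc y) with ((cos y - sinc y) / y) by (rewrite <- dsinc_eq; field; lra).
  transitivity ((y * sinc y * cos y - y * (y ^ 2 * sinc y ^ 2 + cos y ^ 2)) / (y * sinc y) ^ 2).
  - field; lra.
  - rewrite E, Rmult_1_r. reflexivity.
Qed.

Lemma ycos_le_sin y : 0 <= y <= PI -> y * cos y <= sin y.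
Proof.
  intros H. destruct (MVT_gen (fun t => sin t - t * cos t) 0 y (fun t => t * sin t)) as [c [Hc E]].
  - intros t _. eapply is_derive_value.
    + apply (is_derive_minus sin (fun t => t * cos t)); [apply is_derive_sin |].
      apply is_derive_Rmult; [apply (@is_derive_id R_AbsRing) | apply is_derive_cos].
    + unfold minus, plus, opp, one; simpl; ring.
  - intros t _. apply continuity_pt_minus; [apply continuity_sin |].
    apply continuity_pt_mult; [apply continuity_pt_id | apply continuity_cos].
  - rewrite Rmin_left, Rmax_right in Hc by lra. rewrite sin_0 in E.
    generalize (sin_ge_0 c ltac:(lra) ltac:(lra)); intros S.
    assert (0 <= c * sin c * (y - 0)) by (repeat apply Rmult_le_pos; lra). lra.
Qed.

Lemma dxcot_0 : dxcot 0 = 0.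
Proof. generalize (dxcot_odd 0). rewrite Ropp_0. lra. Qed.

Lemma dxcot_neg y : 0 < y < PI -> dxcot y < 0.
Proof.
  intros H. rewrite dxcot_closed by assumption.
  generalize (sin_gt_0 y ltac:(lra) ltac:(lra)) (sin_lt_x y ltac:(lra)) (COS_bound y); intros.
  apply Rmult_lt_reg_r with (sin y ^ 2); [nra |].
  unfold Rdiv; rewrite Rmult_assoc, Rinv_l; nra.
Qed.

(** The second derivative is 2 (y cos y - sin y) / sin^3 y, which is not positive. *)
Lemma dxcot_decr_pos y1 y2 : 0 < y1 -> y1 <= y2 -> y2 < PI -> dxcot y2 <= dxcot y1.
Proof.
  intros H1 H2 H3.
  rewrite !dxcot_closed by lra.
  assert (D : forall t, y1 <= t <= y2 -> is_derive (fun y => (sin y * cos y - y) / (sin y) ^ 2) t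
      (2 * (t * cos t - sin t) / sin t ^ 3)).
  { intros t Ht. generalize (sin_gt_0 t ltac:(lra) ltac:(lra)); intros P.
    auto_derive. nra. generalize (sin2_cos2 t); unfold Rsqr; intros E.
    apply Rminus_diag_uniq.
    transitivity ((1 - (sin t * sin t + cos t * cos t)) / sin t ^ 2); [field; lra |].
    rewrite E. unfold Rdiv; ring. }
  destruct (MVT_gen (fun y => (sin y * cos y - y) / (sin y) ^ 2) y1 y2 (fun t => 2 * (t * cos t - sin t) / sin t ^ 3)) as [c [Hc E]].
  - rewrite Rmin_left, Rmax_right by lra. intros; apply D; lra.
  - rewrite Rmin_left, Rmax_right by lra. intros t Ht.
    eapply is_derive_continuity_pt. apply D, Ht.
  - rewrite Rmin_left, Rmax_right in Hc by lra.
    generalize (ycos_le_sin c ltac:(lra)) (sin_gt_0 c ltac:(lra) ltac:(lra)); intros A B.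
    assert (0 < / sin c ^ 3) by (apply Rinv_0_lt_compat, pow_lt, B).
    assert (0 <= (sin c - c * cos c) * / sin c ^ 3 * (y2 - y1)) by (repeat apply Rmult_le_pos; lra).
    unfold Rdiv in *. nra.
Qed.

(** Concavity of y cot y across 0: its derivative is odd, and on the positive side it is
    negative and decreasing. *)
Lemma dxcot_decr y1 y2 : - PI < y1 -> y1 <= y2 -> y2 < PI -> dxcot y2 <= dxcot y1.
Proof.
  intros H1 H2 H3.
  assert (N : forall y, 0 <= y < PI -> dxcot y <= 0).
  { intros y [[L| <-] Hy]; [left; apply dxcot_neg; lra | rewrite dxcot_0; lra]. }
  destruct (Rlt_le_dec 0 y1) as [L1|L1]; [apply dxcot_decr_pos; lra |].
  generalize (N (- y1) ltac:(lra)); rewrite dxcot_odd; intros.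
  destruct (Rlt_le_dec y2 0) as [L2|L2].
  - generalize (dxcot_decr_pos (- y2) (- y1) ltac:(lra) ltac:(lra) ltac:(lra)).
    rewrite !dxcot_odd. lra.
  - generalize (N y2 ltac:(lra)). lra.
Qed.

Lemma xcot_tangent m y : Rabs m < PI -> Rabs y < PI -> xcot y <= xcot m + dxcot m * (y - m).
Proof.
  intros Hm Hy. apply Rabs_def2 in Hm. apply Rabs_def2 in Hy.
  destruct (MVT_gen xcot m y dxcot) as [c [Hc E]].
  - intros t Ht. apply xcot_derive. revert Ht; unfold Rmin, Rmax; destruct Rle_dec; intros; apply Rabs_def1; lra.
  - intros t Ht. apply xcot_cont. revert Ht; unfold Rmin, Rmax; destruct Rle_dec; intros; apply Rabs_def1; lra.
  - destruct (Rle_lt_dec m y) as [L|L].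
    + rewrite Rmin_left, Rmax_right in Hc by lra.
      generalize (dxcot_decr m c ltac:(lra) ltac:(lra) ltac:(lra)). nra.
    + rewrite Rmin_right, Rmax_left in Hc by lra.
      generalize (dxcot_decr c m ltac:(lra) ltac:(lra) ltac:(lra)). nra.
Qed.

Lemma convex_pos s a b : 0 <= s <= 1 -> 0 < a -> 0 < b -> 0 < (1 - s) * a + s * b.
Proof. intros Hs Ha Hb. destruct (Rle_lt_dec s (1 / 2)); nra. Qed.

Lemma xcot_concave s y1 y2 :
  0 <= s <= 1 -> Rabs y1 < PI -> Rabs y2 < PI ->
  Rabs ((1 - s) * y1 + s * y2) < PI /\
  (1 - s) * xcot y1 + s * xcot y2 <= xcot ((1 - s) * y1 + s * y2).
Proof.
  intros Hs H1 H2.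
  assert (H : Rabs ((1 - s) * y1 + s * y2) < PI).
  { apply Rabs_def2 in H1. apply Rabs_def2 in H2.
    generalize (convex_pos s (PI - y1) (PI - y2) Hs ltac:(lra) ltac:(lra)).
    generalize (convex_pos s (y1 + PI) (y2 + PI) Hs ltac:(lra) ltac:(lra)).
    intros; apply Rabs_def1; lra. }
  split; [exact H |].
  generalize (xcot_tangent _ _ H H1) (xcot_tangent _ _ H H2).
  set (m := (1 - s) * y1 + s * y2). intros A B.
  assert (E : (1 - s) * (y1 - m) + s * (y2 - m) = 0) by (unfold m; ring).
  apply (Rmult_le_compat_l (1 - s)) in A; [| lra].
  apply (Rmult_le_compat_l s) in B; [| lra].
  replace (xcot m) with ((1 - s) * (xcot m + dxcot m * (y1 - m)) + s * (xcot m + dxcot m * (y2 - m))).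
  - lra.
  - transitivity (xcot m + dxcot m * ((1 - s) * (y1 - m) + s * (y2 - m))); [ring |].
    rewrite E; ring.
Qed.

(** An even concave function decreases away from 0; here V is the end of the interval
    and y is a convex combination of - V and V. *)
Lemma xcot_min V y : 0 < V < PI -> - V <= y <= V -> xcot V <= xcot y.
Proof.
  intros HV Hy.
  assert (HA : Rabs V < PI) by (apply Rabs_def1; lra).
  assert (HB : Rabs (- V) < PI) by (apply Rabs_def1; lra).
  assert (P : 0 <= (y + V) / (2 * V) <= 1).
  { split; [apply Rdiv_le_0_compat; lra |]. apply Rmult_le_reg_r with (2 * V); [lra |].
    unfold Rdiv; rewrite Rmult_assoc, Rinv_l; lra. }
  destruct (xcot_concave _ (- V) V P HB HA) as [_ E].
  rewrite xcot_even in E.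
  replace ((1 - (y + V) / (2 * V)) * - V + (y + V) / (2 * V) * V) with y in E by (field; lra).
  lra.
Qed.

Lemma xcot_0 : xcot 0 = 1.
Proof. unfold xcot. rewrite cos_0, sinc_0. field. Qed.

Lemma xcot_minus_infty A :
  exists V0, 0 < V0 < PI /\ forall V, V0 < V < PI -> xcot V < - A.
Proof.
  generalize PI_RGT_0; intros Ppi.
  set (B := Rmax A 1). assert (HB : 1 <= B /\ A <= B) by (split; [apply Rmax_r | apply Rmax_l]).
  assert (Pe : 0 < / (2 * B)) by (apply Rinv_0_lt_compat; lra).
  assert (S : sinc PI = 0) by (generalize (sin_eq_sinc PI); rewrite sin_PI; nra).
  destruct (proj1 (continuity_pt_locally sinc PI) (sinc_cont PI) (mkposreal _ Pe)) as [d1 H1].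
  assert (Ph : 0 < 1 / 2) by lra.
  destruct (proj1 (continuity_pt_locally cos PI) (continuity_cos PI) (mkposreal _ Ph)) as [d2 H2].
  assert (Pm : 0 < Rmin (PI / 2) (Rmin d1 d2)).
  { repeat apply Rmin_pos; try apply cond_pos; lra. }
  set (m := Rmin (PI / 2) (Rmin d1 d2)) in *.
  assert (m <= PI / 2 /\ m <= d1 /\ m <= d2) as (M1 & M2 & M3).
  { unfold m; repeat split; [apply Rmin_l | eapply Rle_trans; [apply Rmin_r | apply Rmin_l] | eapply Rle_trans; [apply Rmin_r | apply Rmin_r]]. }
  exists (PI - m). split; [lra |]. intros V HV.
  assert (K : Rabs (V - PI) < m) by (apply Rabs_def1; lra).
  specialize (H1 V (Rlt_le_trans _ _ _ K M2)). specialize (H2 V (Rlt_le_trans _ _ _ K M3)).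
  simpl in H1, H2. rewrite S in H1. rewrite cos_PI in H2.
  apply Rabs_def2 in H1. apply Rabs_def2 in H2.
  assert (P : 0 < sinc V) by (apply sinc_pos, Rabs_def1; lra).
  unfold xcot. apply Rmult_lt_reg_r with (sinc V); [assumption |].
  unfold Rdiv; rewrite Rmult_assoc, Rinv_l by lra.
  assert (sinc V * B < 1 / 2).
  { replace (1 / 2) with (/ (2 * B) * B) by (field; lra). apply Rmult_lt_compat_r; lra. }
  nra.
Qed.

(** * The domain enclosed by the curve v cot v + i v, and injectivity of w exp(- w) on it *)

Lemma Cexp_plus z w : Cexp (z + w)%C = (Cexp z * Cexp w)%C.
Proof.
  unfold Cexp, Cplus, Cmult, Re, Im; simpl. rewrite exp_plus, cos_plus, sin_plus.
  f_equal; ring.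
Qed.

Lemma Cexp_0 : Cexp (RtoC 0) = RtoC 1.
Proof. unfold Cexp, RtoC, Re, Im; simpl. rewrite exp_0, cos_0, sin_0. f_equal; ring. Qed.

Lemma Cexp_opp_r z : (Cexp z * Cexp (- z))%C = RtoC 1.
Proof. rewrite <- Cexp_plus, Cplus_opp_r. apply Cexp_0. Qed.

Lemma Cexp_neq0 z : Cexp z <> RtoC 0.
Proof.
  intros E. generalize (Cexp_opp_r z). rewrite E, Cmult_0_l. intros F.
  apply (f_equal Re) in F. simpl in F. lra.
Qed.

Lemma Cmod_Cexp u : Cmod (Cexp u) = exp (Re u).
Proof.
  unfold Cmod, Cexp; simpl. generalize (sin2_cos2 (Im u)) (exp_pos (Re u)); unfold Rsqr; intros E P.
  transitivity (sqrt (exp (Re u) * exp (Re u))); [| apply sqrt_square; lra]. f_equal.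
  transitivity (exp (Re u) * exp (Re u) * (sin (Im u) * sin (Im u) + cos (Im u) * cos (Im u))); [ring |].
  rewrite E; ring.
Qed.

(** Its value at - W z is - z, so that solving w + z e^w = 0 means inverting this map. *)
Definition wexp (w : C) : C := (w * Cexp (- w))%C.

Definition Omega (w : C) : Prop := Rabs (Im w) < PI /\ Re w < xcot (Im w).
Definition Omega_cl (w : C) : Prop := Rabs (Im w) < PI /\ Re w <= xcot (Im w).

Lemma Re_wexp w : Re (wexp w) = exp (- Re w) * (Re w * cos (Im w) + Im w * sin (Im w)).
Proof. unfold wexp, Cexp, Cmult, Copp, Re, Im; simpl. rewrite cos_neg, sin_neg. ring. Qed.

Lemma Im_wexp w : Im (wexp w) = exp (- Re w) * (Im w * cos (Im w) - Re w * sin (Im w)).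
Proof. unfold wexp, Cexp, Cmult, Copp, Re, Im; simpl. rewrite cos_neg, sin_neg. ring. Qed.

(** Inside the domain the factor in front of Im w is positive, so that w e^(- w) and w lie
    in the same half-plane. *)
Lemma Im_wexp_xcot w :
  Rabs (Im w) < PI ->
  Im (wexp w) = exp (- Re w) * sinc (Im w) * (xcot (Im w) - Re w) * Im w.
Proof.
  intros H. generalize (sinc_pos _ H); intros P. rewrite Im_wexp, (sin_eq_sinc (Im w)).
  unfold xcot. field. lra.
Qed.

(** On the curve w = e^(i y) / sinc y, so the phases of w and of e^(- w) cancel. *)
Lemma wexp_boundary y :
  Rabs y < PI -> wexp (xcot y, y) = RtoC (exp (- xcot y) / sinc y).
Proof.
  intros H. generalize (sinc_pos _ H); intros P. apply injective_projections.
  - change (Re (wexp (xcot y, y)) = exp (- xcot y) / sinc y). rewrite Re_wexp. simpl.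
    generalize (sin2_cos2 y); unfold Rsqr. rewrite !(sin_eq_sinc y). intros E.
    transitivity (exp (- xcot y) * ((y * sinc y * (y * sinc y) + cos y * cos y) / sinc y)).
    + f_equal. unfold xcot. field. lra.
    + rewrite E. unfold Rdiv; ring.
  - change (Im (wexp (xcot y, y)) = 0). rewrite Im_wexp_xcot by assumption. simpl. ring.
Qed.

Lemma wexp_conj w : wexp (Cconj w) = Cconj (wexp w).
Proof.
  unfold wexp, Cexp, Cconj, Cmult, Copp, Re, Im; simpl. rewrite !cos_neg, !sin_neg.
  f_equal; ring.
Qed.

Lemma wexp_norm2 w :
  Re (wexp w) ^ 2 + Im (wexp w) ^ 2 = exp (- Re w) ^ 2 * (Re w ^ 2 + Im w ^ 2).
Proof.
  rewrite Re_wexp, Im_wexp. generalize (sin2_cos2 (Im w)); unfold Rsqr; intros E.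
  transitivity (exp (- Re w) ^ 2 * ((Re w ^ 2 + Im w ^ 2) * (sin (Im w) * sin (Im w) + cos (Im w) * cos (Im w)))).
  - ring.
  - rewrite E; ring.
Qed.

(** For Im w > 0 the argument of w is pi / 2 - atan (Re w / Im w), so this is pi / 2 minus
    the imaginary part of log w - w. The real part of log w - w is the next definition. *)
Definition arg_defect (w : C) : R := atan (Re w / Im w) + Im w.
Definition mod_defect (w : C) : R := ln (Re w ^ 2 + Im w ^ 2) / 2 - Re w.

(** The imaginary part of log w - w is determined by w e^(- w) modulo 2 pi only. In the strip
    0 < Im w < pi, and with w e^(- w) in the upper half-plane, it lies in (0, pi), which
    removes the ambiguity. *)
Lemma arg_defect_eq w :
  0 < Im w < PI -> 0 < Im (wexp w) ->
  arg_defect w = atan (Re (wexp w) / Im (wexp w)).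
Proof.
  intros Hy Hp. unfold arg_defect. set (q := Re w / Im w).
  assert (Hx : Re w = q * Im w) by (unfold q; field; lra).
  generalize (atan_bound q); intros [B1 B2].
  assert (Cq : 0 < cos (atan q)) by (apply cos_gt_0; lra).
  assert (Sq : sin (atan q) = q * cos (atan q)).
  { rewrite <- (tan_atan q) at 2. unfold tan. field. lra. }
  rewrite Im_wexp, Hx in Hp.
  assert (Hp' : 0 < cos (Im w) - q * sin (Im w)).
  { generalize (exp_pos (- (q * Im w))). intros.
    apply Rmult_lt_reg_l with (exp (- (q * Im w)) * Im w); [apply Rmult_lt_0_compat; lra |].
    rewrite Rmult_0_r. eapply Rlt_le_trans; [exact Hp | right; ring]. }
  assert (Cs : 0 < cos (atan q + Im w)).
  { rewrite cos_plus, Sq. replace (cos (atan q) * cos (Im w) - q * cos (atan q) * sin (Im w))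
      with (cos (atan q) * (cos (Im w) - q * sin (Im w))) by ring.
    apply Rmult_lt_0_compat; assumption. }
  assert (U : atan q + Im w < PI / 2).
  { destruct (Rlt_le_dec (atan q + Im w) (PI / 2)) as [L|L]; [exact L |].
    generalize (cos_le_0 (atan q + Im w) L ltac:(lra)). lra. }
  rewrite <- (atan_tan (atan q + Im w)) by lra.
  f_equal. unfold tan. rewrite Re_wexp, Im_wexp, sin_plus, cos_plus, Sq, Hx.
  generalize (exp_pos (- (q * Im w))); intros.
  field. repeat split; try lra. 
  - replace (q * sin (Im w) * Im w) with (Im w * (q * sin (Im w))) by ring. nra.
  - nra.
Qed.

(** A variant of the Noshiro-Warschawski argument: w e^(- w) determines log w - w, whose
    derivative 1 / w - 1 has negative imaginary part on the convex upper half-plane. Hence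
    log w - w cannot take the same value at two points of that half-plane. *)
Lemma wexp_inj_upper w1 w2 :
  0 < Im w1 < PI -> 0 < Im w2 < PI -> 0 < Im (wexp w1) -> wexp w1 = wexp w2 -> w1 = w2.
Proof.
  intros H1 H2 Hp E.
  assert (EA : arg_defect w1 = arg_defect w2).
  { rewrite !arg_defect_eq; rewrite <- ?E; auto. }
  assert (EM : mod_defect w1 = mod_defect w2).
  { assert (F : forall w, 0 < Im w -> 2 * mod_defect w = ln (Re (wexp w) ^ 2 + Im (wexp w) ^ 2)).
    { intros w Hw. rewrite wexp_norm2, ln_mult; [| apply pow_lt, exp_pos | nra].
      simpl (exp (- Re w) ^ 2). rewrite Rmult_1_r, <- exp_plus, ln_exp. unfold mod_defect. field. }
    generalize (F w1 ltac:(lra)) (F w2 ltac:(lra)). rewrite <- E. lra. }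
  destruct w1 as [x1 y1], w2 as [x2 y2]; unfold arg_defect, mod_defect, Re, Im in *; simpl in *.
  set (p := x2 - x1). set (q := y2 - y1).
  set (x := fun t => x1 + t * p). set (y := fun t => y1 + t * q).
  assert (Y : forall t, 0 <= t <= 1 -> 0 < y t).
  { intros t Ht. replace (y t) with ((1 - t) * y1 + t * y2) by (unfold y, q; ring).
    apply convex_pos; lra. }
  (* Up to a constant, this is the imaginary part of conj(w2 - w1) (log w - w) at
     w = w1 + t (w2 - w1). *)
  assert (D : forall t, 0 <= t <= 1 -> is_derive (fun t => p * (- (atan (x t / y t) + y t))
      - q * (ln (x t ^ 2 + y t ^ 2) / 2 - x t)) t (- (p ^ 2 + q ^ 2) * y t / (x t ^ 2 + y t ^ 2))).
  { intros t Ht. generalize (Y t Ht); unfold x, y; intros P.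
    assert (0 < (x1 + t * p) ^ 2 + (y1 + t * q) ^ 2).
    { generalize (pow2_ge_0 (x1 + t * p)) (pow_lt _ 2 P). lra. }
    auto_derive; [repeat split; lra |].
    field. repeat split; try lra. }
  destruct (MVT_gen _ 0 1 _ (fun t Ht => D t ltac:(rewrite Rmin_left, Rmax_right in Ht by lra; lra))) as [c [Hc Ec]].
  { intros t Ht. rewrite Rmin_left, Rmax_right in Ht by lra. eapply is_derive_continuity_pt, D, Ht. }
  rewrite Rmin_left, Rmax_right in Hc by lra.
  simpl in Ec.
  generalize (Y c Hc); intros Pc.
  assert (Nc : 0 < x c ^ 2 + y c ^ 2).
  { generalize (pow2_ge_0 (x c)) (pow_lt _ 2 Pc). lra. }
  replace (x 1) with x2 in Ec by (unfold x, p; ring).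
  replace (y 1) with y2 in Ec by (unfold y, q; ring).
  replace (x 0) with x1 in Ec by (unfold x; ring).
  replace (y 0) with y1 in Ec by (unfold y; ring).
  simpl in EM. rewrite EA, EM in Ec.
  assert (Z : (p ^ 2 + q ^ 2) * (y c / (x c ^ 2 + y c ^ 2)) = 0).
  { simpl in *. unfold Rdiv in *. lra. }
  assert (0 < y c / (x c ^ 2 + y c ^ 2)) by (apply Rdiv_lt_0_compat; assumption).
  assert (p ^ 2 + q ^ 2 = 0) by (apply Rmult_integral in Z; destruct Z; lra).
  assert (p = 0) by nra. assert (q = 0) by nra.
  f_equal; unfold p, q in *; lra.
Qed.

(** The imaginary part of w e^(- w) tells on which side of the real axis w lies. In the upper
    half-plane the previous lemma applies, in the lower one it applies after conjugation,
    and negative reals are separated by monotonicity. The hypothesis that wexp a is not a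
    nonnegative real rules out that w lies on the curve in the real case. *)
Lemma wexp_inj a w :
  Omega a -> Omega_cl w -> (Im (wexp a) <> 0 \/ Re (wexp a) < 0) ->
  wexp w = wexp a -> w = a.
Proof.
  intros [Ha1 Ha2] [Hw1 Hw2] Hn E.
  generalize (Im_wexp_xcot a Ha1) (Im_wexp_xcot w Hw1); intros Ia Iw.
  rewrite E in Iw.
  assert (Pa : 0 < exp (- Re a) * sinc (Im a) * (xcot (Im a) - Re a)).
  { repeat apply Rmult_lt_0_compat; [apply exp_pos | apply sinc_pos, Ha1 | lra]. }
  assert (Pw : 0 <= exp (- Re w) * sinc (Im w) * (xcot (Im w) - Re w)).
  { repeat apply Rmult_le_pos; [left; apply exp_pos | left; apply sinc_pos, Hw1 | lra]. }
  destruct (Rtotal_order (Im a) 0) as [L|[L|L]].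
  - assert (Im w < 0) by nra.
    apply Rabs_def2 in Ha1. apply Rabs_def2 in Hw1.
    rewrite <- (Cconj_conj w), <- (Cconj_conj a). f_equal. symmetry.
    apply wexp_inj_upper; rewrite ?im_conj, ?wexp_conj, ?im_conj; try lra; [nra | congruence].
  - assert (Im (wexp a) = 0) by nra. destruct Hn as [Hn|Hn]; [contradiction |].
    assert (Z : (xcot (Im w) - Re w) * Im w = 0).
    { generalize (exp_pos (- Re w)) (sinc_pos _ Hw1); intros.
      assert (Q : exp (- Re w) * sinc (Im w) * ((xcot (Im w) - Re w) * Im w) = 0) by lra.
      apply Rmult_integral in Q; destruct Q as [Q|Q]; [| exact Q].
      assert (0 < exp (- Re w) * sinc (Im w)) by (apply Rmult_lt_0_compat; assumption). lra. }
    apply Rmult_integral in Z. destruct Z as [Z|Z].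
    + exfalso. assert (Ew : w = (xcot (Im w), Im w)) by (apply injective_projections; simpl; unfold Re, Im in *; lra).
      rewrite <- E, Ew, wexp_boundary in Hn by assumption. simpl in Hn.
      assert (0 < exp (- xcot (Im w)) / sinc (Im w)); [| lra].
      apply Rdiv_lt_0_compat; [apply exp_pos | apply sinc_pos, Hw1].
    + assert (EE : exp (- Re w) * Re w = exp (- Re a) * Re a).
      { apply (f_equal Re) in E. rewrite !Re_wexp, Z, L, cos_0, sin_0 in E. lra. }
      assert (Na : exp (- Re a) * Re a < 0).
      { rewrite Re_wexp, L, cos_0, sin_0 in Hn. lra. }
      generalize (exp_pos (- Re w)) (exp_pos (- Re a)); intros P1 P2.
      assert (Re a < 0) by nra. assert (Re w < 0) by nra.
      apply injective_projections; [| change (Im w = Im a); lra]. change (Re w = Re a).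
      destruct (Rtotal_order (Re w) (Re a)) as [T|[T|T]]; [| exact T |].
      * generalize (exp_increasing (- Re a) (- Re w) ltac:(lra)). nra.
      * generalize (exp_increasing (- Re w) (- Re a) ltac:(lra)). nra.
  - assert (0 < Im w) by nra.
    apply Rabs_def2 in Ha1. apply Rabs_def2 in Hw1. symmetry.
    apply wexp_inj_upper; try lra; [nra | congruence].
Qed.

Lemma Omega_cl_segment a w s :
  Omega a -> Omega_cl w -> 0 <= s <= 1 -> Omega_cl (a + RtoC s * (w - a))%C.
Proof.
  intros [A1 A2] [W1 W2] Hs.
  destruct (xcot_concave s (Im a) (Im w) Hs A1 W1) as [B1 B2].
  unfold Omega_cl.
  replace (Im (a + RtoC s * (w - a))%C) with ((1 - s) * Im a + s * Im w)
    by (destruct a, w; simpl; ring).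
  replace (Re (a + RtoC s * (w - a))%C) with ((1 - s) * Re a + s * Re w)
    by (destruct a, w; simpl; ring).
  split; [exact B1 | nra].
Qed.

Lemma shifted_den_neq0 a w :
  Omega a -> Omega_cl w -> (Im (wexp a) <> 0 \/ Re (wexp a) < 0) -> w <> a ->
  (w - a * Cexp (w - a))%C <> RtoC 0.
Proof.
  intros Ha Hw Hn Hne E. apply Hne, wexp_inj; auto.
  unfold wexp.
  assert (F : w = (a * Cexp (w - a))%C).
  { transitivity (w - a * Cexp (w - a) + a * Cexp (w - a))%C; [ring | rewrite E; ring]. }
  rewrite F at 1. unfold Cminus. rewrite Cexp_plus.
  transitivity (a * Cexp (- a) * (Cexp w * Cexp (- w)))%C; [ring |].
  rewrite Cexp_opp_r. ring.
Qed.

(** * Quadratic remainder of the complex exponential *)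

Lemma exp_remainder x : Rabs x <= 1 / 2 -> 0 <= exp x - 1 - x <= 2 * x ^ 2.
Proof.
  intros H. apply Rabs_le_between in H. split.
  - generalize (exp_ineq1_le x). lra.
  - generalize (exp_ineq1_le (- x)) (exp_pos x); intros A P.
    assert (E : exp x * exp (- x) = 1) by (rewrite <- exp_plus, Rplus_opp_r; apply exp_0).
    assert (exp x * (1 - x) <= 1) by nra.
    assert (1 <= (1 + x + 2 * x ^ 2) * (1 - x)) by nra.
    assert (exp x <= 1 + x + 2 * x ^ 2); [| lra].
    apply Rmult_le_reg_r with (1 - x); lra.
Qed.

Lemma one_minus_cos y : 0 <= 1 - cos y <= y ^ 2 / 2.
Proof.
  split; [generalize (COS_bound y); lra |].
  replace y with (2 * (y / 2)) at 1 by field. rewrite cos_2a_sin.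
  assert (S : Rabs (sin (y / 2)) <= Rabs (y / 2)).
  { assert (P : forall t, 0 <= t -> - t <= sin t <= t).
    { intros t [Ht| <-]; [| rewrite sin_0; lra]. generalize (sin_lt_x t Ht). split; [| lra].
      destruct (Rle_lt_dec t PI) as [L|L].
      - generalize (sin_ge_0 t ltac:(lra) L). lra.
      - generalize (SIN_bound t) PI2_1. lra. }
    destruct (Rle_lt_dec 0 (y / 2)) as [L|L].
    - rewrite (Rabs_right (y / 2)) by lra. apply Rabs_le, P, L.
    - rewrite (Rabs_left (y / 2)) by lra. generalize (P (- (y / 2)) ltac:(lra)). rewrite sin_neg.
      intros; apply Rabs_le; lra. }
  apply Rsqr_le_abs_1 in S. unfold Rsqr in S. lra.
Qed.

Lemma sin_remainder y : Rabs y <= 1 / 2 -> Rabs (sin y - y) <= y ^ 2.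
Proof.
  assert (P : forall t, 0 <= t <= 1 / 2 -> Rabs (sin t - t) <= t ^ 2).
  { intros t Ht. generalize (ycos_le_sin t ltac:(generalize PI2_1; lra)) (one_minus_cos t); intros.
    assert (sin t <= t) by (destruct (Req_dec t 0) as [->|]; [rewrite sin_0; lra | generalize (sin_lt_x t); lra]).
    apply Rabs_le. nra. }
  intros H. apply Rabs_le_between in H. destruct (Rle_lt_dec 0 y) as [L|L].
  - apply P; lra.
  - generalize (P (- y) ltac:(lra)). rewrite sin_neg.
    replace (- sin y - - y) with (- (sin y - y)) by ring. rewrite Rabs_Ropp. intros Q.
    replace (y ^ 2) with ((- y) ^ 2) by ring. exact Q.
Qed.

(** The constant 12 is not optimal. Any quadratic bound serves to find the residue. *)
Lemma Cexp_remainder u :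
  Cmod u <= 1 / 2 -> Cmod (Cexp u - RtoC 1 - u)%C <= 12 * Cmod u ^ 2.
Proof.
  intros Hu. set (r := Cmod u) in *.
  assert (Hx : Rabs (Re u) <= r) by apply re_le_Cmod.
  assert (Hy : Rabs (Im u) <= r) by apply im_le_Cmod.
  generalize (exp_remainder (Re u) ltac:(lra)) (one_minus_cos (Im u)) (sin_remainder (Im u) ltac:(lra)).
  intros [A1 A2] [B1 B2] S.
  assert (X2 : Re u ^ 2 <= r ^ 2) by (rewrite <- (pow2_abs (Re u)); apply pow_incr; split; [apply Rabs_pos | assumption]).
  assert (Y2 : Im u ^ 2 <= r ^ 2) by (rewrite <- (pow2_abs (Im u)); apply pow_incr; split; [apply Rabs_pos | assumption]).
  apply Rabs_le_between in Hx. apply Rabs_le_between in Hy. apply Rabs_le_between in S.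
  assert (Ex : 0 < exp (Re u) <= 2) by (split; [apply exp_pos | nra]).
  replace (12 * r ^ 2) with (2 * (6 * r ^ 2)) by ring. apply Cmod_le_of_parts.
  - replace (Re (Cexp u - RtoC 1 - u)%C) with ((exp (Re u) - 1 - Re u) - exp (Re u) * (1 - cos (Im u)))
      by (unfold Cexp, Re, Im; simpl; ring).
    assert (exp (Re u) * (1 - cos (Im u)) <= 2 * (r ^ 2 / 2)) by (apply Rmult_le_compat; lra).
    assert (0 <= exp (Re u) * (1 - cos (Im u))) by (apply Rmult_le_pos; lra).
    apply Rabs_le. lra.
  - replace (Im (Cexp u - RtoC 1 - u)%C)
      with ((exp (Re u) - 1 - Re u) * sin (Im u) + Re u * (sin (Im u) - Im u) + Re u * Im u + (sin (Im u) - Im u))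
      by (unfold Cexp, Re, Im; simpl; ring).
    generalize (SIN_bound (Im u)); intros [T1 T2].
    apply Rabs_le. 
    assert (Q1 : - (2 * r ^ 2) <= (exp (Re u) - 1 - Re u) * sin (Im u) <= 2 * r ^ 2) by nra.
    assert (Q2 : - (r ^ 2) <= Re u * (sin (Im u) - Im u) <= r ^ 2) by (split; nra).
    assert (Q3 : - (r ^ 2) <= Re u * Im u <= r ^ 2) by (split; nra).
    lra.
Qed.

(** * Two exact families of forms *)

(** The function w - a e^(w - a), which is w + z e^w for z = - a e^(- a), at the point
    w = a + s (c - a) of the contour contracted towards a. *)
Definition contracted_den (a : C) (s : R) (c : C) : C :=
  (a + RtoC s * (c - a) - a * Cexp (RtoC s * (c - a)))%C.

(** The form dw / (w - a e^(w - a)), pulled back along w = a + s (c v - a). *)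
Definition contracted_form (a : C) (c dc : R -> C) (s v : R) : C :=
  (RtoC s * dc v * / contracted_den a s (c v))%C.

Definition contracted_form_ds (a : C) (c dc : R -> C) (s v : R) : C :=
  (dc v * / contracted_den a s (c v)
   - RtoC s * dc v * ((c v - a) * (RtoC 1 - a * Cexp (RtoC s * (c v - a))))
     * / (contracted_den a s (c v) * contracted_den a s (c v)))%C.

(** If f is the reciprocal of w - a e^(w - a), then the derivative in s of the form
    s f(a + s (c - a)) dc is the differential of f(a + s (c - a)) (c - a). *)
Definition contracted_prim (a : C) (c : R -> C) (s v : R) : C :=
  ((c v - a) * / contracted_den a s (c v))%C.

Definition is_arc (c dc : R -> C) (v : R) : Prop :=
  is_Cderive c v (dc v) /\ Ccont dc v.

Lemma Ccont2_contracted_den a c s v :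
  Ccont c v -> Ccont2 (fun s v => contracted_den a s (c v)) s v.
Proof.
  intros Hc. unfold contracted_den.
  assert (H : Ccont2 (fun s v => RtoC s * (c v - a))%C s v).
  { apply Ccont2_mult; [apply Ccont2_fst |].
    apply Ccont2_minus; [apply Ccont2_snd, Hc | apply Ccont2_const]. }
  apply Ccont2_minus.
  - apply Ccont2_plus; [apply Ccont2_const | exact H].
  - apply Ccont2_mult; [apply Ccont2_const | apply Ccont2_exp, H].
Qed.

Lemma Ccont2_contracted_form a c dc s v :
  is_arc c dc v -> contracted_den a s (c v) <> RtoC 0 ->
  Ccont2 (contracted_form a c dc) s v.
Proof.
  intros [Hc Hd] H0. apply is_Cderive_cont in Hc. unfold contracted_form.
  apply Ccont2_mult.
  - apply Ccont2_mult; [apply Ccont2_fst | apply Ccont2_snd, Hd].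
  - apply (Ccont2_inv (fun s v => contracted_den a s (c v))); [apply Ccont2_contracted_den, Hc | exact H0].
Qed.

Lemma Ccont2_contracted_form_ds a c dc s v :
  is_arc c dc v -> contracted_den a s (c v) <> RtoC 0 ->
  Ccont2 (contracted_form_ds a c dc) s v.
Proof.
  intros [Hc Hd] H0. apply is_Cderive_cont in Hc. unfold contracted_form_ds.
  assert (Q : Ccont2 (fun s v => contracted_den a s (c v)) s v) by apply Ccont2_contracted_den, Hc.
  assert (E : Ccont2 (fun _ v => c v - a)%C s v).
  { apply Ccont2_minus; [apply Ccont2_snd, Hc | apply Ccont2_const]. }
  apply Ccont2_minus.
  - apply Ccont2_mult; [apply Ccont2_snd, Hd |].
    apply (Ccont2_inv (fun s v => contracted_den a s (c v))); assumption.
  - apply Ccont2_mult.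
    + apply Ccont2_mult.
      * apply Ccont2_mult; [apply Ccont2_fst | apply Ccont2_snd, Hd].
      * apply Ccont2_mult; [exact E |]. apply Ccont2_minus; [apply Ccont2_const |].
        apply Ccont2_mult; [apply Ccont2_const | apply Ccont2_exp].
        apply Ccont2_mult; [apply Ccont2_fst | exact E].
    + apply (Ccont2_inv (fun s v => contracted_den a s (c v) * contracted_den a s (c v))%C).
      * apply Ccont2_mult; assumption.
      * apply Cmult_neq_0; assumption.
Qed.

Lemma contracted_form_derive_s a c dc s v :
  is_arc c dc v -> contracted_den a s (c v) <> RtoC 0 ->
  locally_2d (fun u w => is_Cderive (fun t => contracted_form a c dc t w) u (contracted_form_ds a c dc u w)) s v.
Proof.
  intros [Hc Hd] H0. apply is_Cderive_cont in Hc.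
  destruct (Ccont2_neq0 _ _ _ (Ccont2_contracted_den a c s v Hc) H0) as [e He].
  exists e; intros u w Hu Hw. generalize (He u w Hu Hw); intros N.
  unfold contracted_form. eapply is_Cderive_value.
  - apply is_Cderive_mult.
    + apply is_Cderive_mult; [apply is_Cderive_id | apply is_Cderive_const].
    + apply (is_Cderive_inv (fun t => contracted_den a t (c w))); [| exact N].
      assert (H : is_Cderive (fun t => RtoC t * (c w - a))%C u (RtoC 1 * (c w - a) + RtoC u * RtoC 0)%C).
      { apply (is_Cderive_mult (fun t => RtoC t)); [apply is_Cderive_id | apply is_Cderive_const]. }
      unfold contracted_den. apply is_Cderive_minus.
      * apply is_Cderive_plus; [apply is_Cderive_const | exact H].
      * apply is_Cderive_mult; [apply is_Cderive_const | apply is_Cderive_exp, H].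
  - unfold contracted_form_ds. field. exact N.
Qed.

Lemma contracted_prim_derive_v a c dc s v :
  is_arc c dc v -> contracted_den a s (c v) <> RtoC 0 ->
  is_Cderive (contracted_prim a c s) v (contracted_form_ds a c dc s v).
Proof.
  intros [Hc Hd] N. unfold contracted_prim.
  assert (E : is_Cderive (fun v => c v - a)%C v (dc v - RtoC 0)%C).
  { apply is_Cderive_minus; [exact Hc | apply is_Cderive_const]. }
  eapply is_Cderive_value.
  - apply is_Cderive_mult; [exact E |].
    apply (is_Cderive_inv (fun v => contracted_den a s (c v))); [| exact N].
    assert (H : is_Cderive (fun v => RtoC s * (c v - a))%C v (RtoC 0 * (c v - a) + RtoC s * (dc v - RtoC 0))%C).
    { apply (is_Cderive_mult (fun _ => RtoC s)); [apply is_Cderive_const | exact E]. }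
    unfold contracted_den. apply is_Cderive_minus.
    + apply is_Cderive_plus; [apply is_Cderive_const | exact H].
    + apply is_Cderive_mult; [apply is_Cderive_const | apply is_Cderive_exp, H].
  - unfold contracted_form_ds. field. exact N.
Qed.

(** The form k dw / (w - t a); its derivative in t is the differential of
    - k a / (w - t a). *)
Definition winding_form (k a : C) (c dc : R -> C) (t v : R) : C :=
  (k * dc v * / (c v - RtoC t * a))%C.
Definition winding_form_dt (k a : C) (c dc : R -> C) (t v : R) : C :=
  (k * a * dc v * / ((c v - RtoC t * a) * (c v - RtoC t * a)))%C.
Definition winding_prim (k a : C) (c : R -> C) (t v : R) : C :=
  (- (k * a) * / (c v - RtoC t * a))%C.

Lemma Ccont2_winding_den a c t v :
  Ccont c v -> Ccont2 (fun t v => c v - RtoC t * a)%C t v.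
Proof.
  intros Hc. apply Ccont2_minus; [apply Ccont2_snd, Hc |].
  apply Ccont2_mult; [apply Ccont2_fst | apply Ccont2_const].
Qed.

Lemma Ccont2_winding_form k a c dc t v :
  is_arc c dc v -> (c v - RtoC t * a)%C <> RtoC 0 -> Ccont2 (winding_form k a c dc) t v.
Proof.
  intros [Hc Hd] H0. apply is_Cderive_cont in Hc. unfold winding_form.
  apply Ccont2_mult.
  - apply Ccont2_mult; [apply Ccont2_const | apply Ccont2_snd, Hd].
  - apply Ccont2_inv; [apply Ccont2_winding_den, Hc | exact H0].
Qed.

Lemma Ccont2_winding_form_dt k a c dc t v :
  is_arc c dc v -> (c v - RtoC t * a)%C <> RtoC 0 -> Ccont2 (winding_form_dt k a c dc) t v.
Proof.
  intros [Hc Hd] H0. apply is_Cderive_cont in Hc. unfold winding_form_dt.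
  apply Ccont2_mult.
  - apply Ccont2_mult; [apply Ccont2_const | apply Ccont2_snd, Hd].
  - apply (Ccont2_inv (fun t v => (c v - RtoC t * a) * (c v - RtoC t * a))%C).
    + apply Ccont2_mult; apply Ccont2_winding_den, Hc.
    + apply Cmult_neq_0; exact H0.
Qed.

Lemma winding_form_derive_t k a c dc t v :
  is_arc c dc v -> (c v - RtoC t * a)%C <> RtoC 0 ->
  locally_2d (fun u w => is_Cderive (fun t => winding_form k a c dc t w) u (winding_form_dt k a c dc u w)) t v.
Proof.
  intros [Hc Hd] H0. apply is_Cderive_cont in Hc.
  destruct (Ccont2_neq0 _ _ _ (Ccont2_winding_den a c t v Hc) H0) as [e He].
  exists e; intros u w Hu Hw. generalize (He u w Hu Hw); intros N.
  unfold winding_form. eapply is_Cderive_value.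
  - apply is_Cderive_mult; [apply is_Cderive_const |].
    apply (is_Cderive_inv (fun t => c w - RtoC t * a)%C); [| exact N].
    apply is_Cderive_minus; [apply is_Cderive_const |].
    apply (is_Cderive_mult (fun t => RtoC t)); [apply is_Cderive_id | apply is_Cderive_const].
  - unfold winding_form_dt. field. exact N.
Qed.

Lemma winding_prim_derive_v k a c dc t v :
  is_arc c dc v -> (c v - RtoC t * a)%C <> RtoC 0 ->
  is_Cderive (winding_prim k a c t) v (winding_form_dt k a c dc t v).
Proof.
  intros [Hc Hd] N. unfold winding_prim. eapply is_Cderive_value.
  - apply is_Cderive_mult; [apply is_Cderive_const |].
    apply (is_Cderive_inv (fun v => c v - RtoC t * a)%C); [| exact N].
    apply is_Cderive_minus; [exact Hc | apply is_Cderive_const].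
  - unfold winding_form_dt. field. exact N.
Qed.

Lemma locally_2d_Cderive_minus K1 K2 D1 D2 s v :
  locally_2d (fun u w => is_Cderive (fun t => K1 t w) u (D1 u w)) s v ->
  locally_2d (fun u w => is_Cderive (fun t => K2 t w) u (D2 u w)) s v ->
  locally_2d (fun u w => is_Cderive (fun t => K1 t w - K2 t w)%C u (D1 u w - D2 u w)%C) s v.
Proof.
  intros [e1 H1] [e2 H2].
  assert (P : 0 < Rmin e1 e2) by (apply Rmin_pos; apply cond_pos).
  exists (mkposreal _ P); simpl; intros u w Hu Hw.
  generalize (Rmin_l e1 e2) (Rmin_r e1 e2); intros.
  apply is_Cderive_minus; [apply H1 | apply H2]; lra.
Qed.

(** Two arcs with common end points form a closed contour when the second one is reversed;
    the difference of the integrands is the integrand of that contour. *)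
Lemma contracted_integral_const a c1 dc1 c2 dc2 al be lo :
  al <= be -> lo <= 1 ->
  (forall v, al <= v <= be -> is_arc c1 dc1 v /\ is_arc c2 dc2 v) ->
  c1 al = c2 al -> c1 be = c2 be ->
  (forall s v, lo <= s <= 1 -> al <= v <= be ->
     contracted_den a s (c1 v) <> RtoC 0 /\ contracted_den a s (c2 v) <> RtoC 0) ->
  CInt (fun v => contracted_form a c1 dc1 lo v - contracted_form a c2 dc2 lo v)%C al be =
  CInt (fun v => contracted_form a c1 dc1 1 v - contracted_form a c2 dc2 1 v)%C al be.
Proof.
  intros Hab Hl Hc E1 E2 N.
  apply (CInt_exact_family
    (fun s v => contracted_form a c1 dc1 s v - contracted_form a c2 dc2 s v)%C
    (fun s v => contracted_form_ds a c1 dc1 s v - contracted_form_ds a c2 dc2 s v)%C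
    (fun s v => contracted_prim a c1 s v - contracted_prim a c2 s v)%C lo 1 al be Hab Hl).
  - intros s v Hs Hv. destruct (Hc v Hv), (N s v Hs Hv).
    apply Ccont2_minus; apply Ccont2_contracted_form; assumption.
  - intros s v Hs Hv. destruct (Hc v Hv), (N s v ltac:(lra) Hv).
    apply locally_2d_Cderive_minus; apply contracted_form_derive_s; assumption.
  - intros s v Hs Hv. destruct (Hc v Hv), (N s v ltac:(lra) Hv).
    apply Ccont2_minus; apply Ccont2_contracted_form_ds; assumption.
  - intros s v Hs Hv. destruct (Hc v Hv), (N s v ltac:(lra) Hv).
    apply is_Cderive_minus; apply contracted_prim_derive_v; assumption.
  - intros s Hs. unfold contracted_prim. rewrite E1, E2. ring.
Qed.

Lemma winding_integral_const k a c1 dc1 c2 dc2 al be :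
  al <= be ->
  (forall v, al <= v <= be -> is_arc c1 dc1 v /\ is_arc c2 dc2 v) ->
  c1 al = c2 al -> c1 be = c2 be ->
  (forall t v, 0 <= t <= 1 -> al <= v <= be ->
     (c1 v - RtoC t * a)%C <> RtoC 0 /\ (c2 v - RtoC t * a)%C <> RtoC 0) ->
  CInt (fun v => winding_form k a c1 dc1 0 v - winding_form k a c2 dc2 0 v)%C al be =
  CInt (fun v => winding_form k a c1 dc1 1 v - winding_form k a c2 dc2 1 v)%C al be.
Proof.
  intros Hab Hc E1 E2 N.
  apply (CInt_exact_family
    (fun s v => winding_form k a c1 dc1 s v - winding_form k a c2 dc2 s v)%C
    (fun s v => winding_form_dt k a c1 dc1 s v - winding_form_dt k a c2 dc2 s v)%C
    (fun s v => winding_prim k a c1 s v - winding_prim k a c2 s v)%C 0 1 al be Hab Rle_0_1).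
  - intros s v Hs Hv. destruct (Hc v Hv), (N s v Hs Hv).
    apply Ccont2_minus; apply Ccont2_winding_form; assumption.
  - intros s v Hs Hv. destruct (Hc v Hv), (N s v ltac:(lra) Hv).
    apply locally_2d_Cderive_minus; apply winding_form_derive_t; assumption.
  - intros s v Hs Hv. destruct (Hc v Hv), (N s v ltac:(lra) Hv).
    apply Ccont2_minus; apply Ccont2_winding_form_dt; assumption.
  - intros s v Hs Hv. destruct (Hc v Hv), (N s v ltac:(lra) Hv).
    apply is_Cderive_minus; apply winding_prim_derive_v; assumption.
  - intros s Hs. unfold winding_prim. rewrite E1, E2. ring.
Qed.

(** * The residue at the pole, and the truncated contour *)

(** With u = s (c - a) the denominator is (1 - a) u - a (e^u - 1 - u), whose second term is
    quadratic in u. Hence the error is O(s), uniformly in all c with s |c - a| small. *)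
Lemma contracted_pole a :
  (RtoC 1 - a)%C <> RtoC 0 ->
  exists eta L, 0 < eta /\ 0 < L /\ forall s c, 0 < s -> c <> a -> s * Cmod (c - a) <= eta ->
    Cmod (RtoC s * / contracted_den a s c - / (RtoC 1 - a) * / (c - a))%C <= L * s.
Proof.
  intros H1. assert (P1 : 0 < Cmod (1 - a)) by (apply Cmod_gt_0, H1).
  assert (Pa : 0 <= Cmod a) by apply Cmod_ge_0.
  set (m := Cmod (1 - a)) in *. set (al := Cmod a) in *.
  assert (Pd : 0 < 24 * al + 1) by lra.
  exists (Rmin (1 / 2) (m / (24 * al + 1))), (24 * al / (m * m) + 1).
  assert (Pm : 0 < m / (24 * al + 1)) by (apply Rdiv_lt_0_compat; lra).
  repeat split.
  - apply Rmin_pos; lra.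
  - assert (0 <= 24 * al / (m * m)); [| lra]. apply Rdiv_le_0_compat; nra.
  - intros s c Hs Hc Hle.
    assert (Hca : (c - a)%C <> RtoC 0).
    { intros E; apply Hc. replace c with (c - a + a)%C by ring. rewrite E; ring. }
    set (d := (c - a)%C) in *. set (u := (RtoC s * d)%C).
    assert (Mu : Cmod u = s * Cmod d) by (unfold u; rewrite Cmod_mult, Cmod_R, Rabs_right; lra).
    assert (Pdd : 0 < Cmod d) by (apply Cmod_gt_0, Hca).
    assert (Pu : 0 < Cmod u) by (rewrite Mu; apply Rmult_lt_0_compat; assumption).
    assert (U1 : Cmod u <= 1 / 2) by (rewrite Mu; eapply Rle_trans; [exact Hle | apply Rmin_l]).
    assert (U2 : Cmod u * (24 * al + 1) <= m).
    { apply Rle_trans with (m / (24 * al + 1) * (24 * al + 1)); [| right; field; lra].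
      apply Rmult_le_compat_r; [lra |]. rewrite Mu; eapply Rle_trans; [exact Hle | apply Rmin_r]. }
    set (E := (Cexp u - RtoC 1 - u)%C).
    assert (HE : Cmod E <= 12 * Cmod u ^ 2) by (apply Cexp_remainder, U1).
    set (q := contracted_den a s c).
    assert (Hq : q = ((RtoC 1 - a) * u - a * E)%C).
    { unfold q, contracted_den, E. fold d. fold u. ring. }
    assert (Mq : m * Cmod u / 2 <= Cmod q).
    { assert (T : m * Cmod u <= Cmod q + al * Cmod E).
      { unfold m, al. rewrite <- !Cmod_mult. replace ((RtoC 1 - a) * u)%C with (q + a * E)%C by (rewrite Hq; ring).
        apply Cmod_triangle. }
      assert (al * Cmod E <= al * (12 * Cmod u ^ 2)) by (apply Rmult_le_compat_l; assumption).
      assert (al * (12 * Cmod u ^ 2) <= m * Cmod u / 2).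
      { replace (al * (12 * Cmod u ^ 2)) with (Cmod u / 2 * (Cmod u * (24 * al))) by field.
        replace (m * Cmod u / 2) with (Cmod u / 2 * m) by field.
        apply Rmult_le_compat_l; [lra | nra]. }
      lra. }
    assert (Pq : 0 < Cmod q) by (assert (0 < m * Cmod u) by (apply Rmult_lt_0_compat; assumption); lra).
    assert (Nq : q <> RtoC 0) by (apply Cmod_gt_0, Pq).
    replace (RtoC s * / q - / (RtoC 1 - a) * / d)%C with (a * E / ((RtoC 1 - a) * d * q))%C.
    2:{ assert (HE2 : (a * E)%C = ((RtoC 1 - a) * (RtoC s * d) - q)%C) by (rewrite Hq; unfold u; ring).
        rewrite HE2. field. repeat split; assumption. }
    rewrite Cmod_div by (repeat apply Cmult_neq_0; assumption).
    rewrite !Cmod_mult. fold m al.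
    assert (PP : 0 < m * Cmod d * Cmod q) by (repeat apply Rmult_lt_0_compat; assumption).
    apply Rmult_le_reg_r with (m * Cmod d * Cmod q); [exact PP |].
    unfold Rdiv. rewrite Rmult_assoc, Rinv_l, Rmult_1_r by lra.
    apply Rle_trans with (al * (12 * Cmod u ^ 2)); [apply Rmult_le_compat_l; assumption |].
    apply Rle_trans with ((24 * al * / (m * m)) * s * (m * Cmod d * (m * Cmod u / 2))).
    + right. rewrite Mu. field. lra.
    + assert (0 <= 24 * al * / (m * m)).
      { apply Rmult_le_pos; [lra |]. left; apply Rinv_0_lt_compat, Rmult_lt_0_compat; assumption. }
      apply Rmult_le_compat.
      * apply Rmult_le_pos; lra.
      * repeat apply Rmult_le_pos; try lra.
      * apply Rmult_le_compat_r; lra.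
      * apply Rmult_le_compat_l; [| exact Mq]. apply Rmult_le_pos; lra.
Qed.

(** The integral over the contracted contour does not depend on s, and for small s it is
    close to the integral of dw / ((1 - a) (w - a)); that one does not change when its pole
    moves from a to 0. *)
Lemma residue_at_pole a c1 dc1 c2 dc2 al be :
  al <= be -> (RtoC 1 - a)%C <> RtoC 0 ->
  (forall v, al <= v <= be -> is_arc c1 dc1 v /\ is_arc c2 dc2 v) ->
  c1 al = c2 al -> c1 be = c2 be ->
  (forall s v, 0 < s <= 1 -> al <= v <= be ->
     contracted_den a s (c1 v) <> RtoC 0 /\ contracted_den a s (c2 v) <> RtoC 0) ->
  (forall t v, 0 <= t <= 1 -> al <= v <= be ->
     (c1 v - RtoC t * a)%C <> RtoC 0 /\ (c2 v - RtoC t * a)%C <> RtoC 0) ->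
  CInt (fun v => contracted_form a c1 dc1 1 v - contracted_form a c2 dc2 1 v)%C al be =
  CInt (fun v => winding_form (/ (RtoC 1 - a)) a c1 dc1 0 v
               - winding_form (/ (RtoC 1 - a)) a c2 dc2 0 v)%C al be.
Proof.
  intros Hab H1 Hc E1 E2 N NW. set (k := (/ (RtoC 1 - a))%C).
  assert (NW1 : forall v, al <= v <= be -> c1 v <> a /\ c2 v <> a).
  { intros v Hv. destruct (NW 1 v ltac:(lra) Hv) as [A B].
    split; intros F; [apply A | apply B]; rewrite F; ring. }
  destruct (contracted_pole a H1) as (eta & L & Peta & PL & HL).
  destruct (Ccont_bounded dc1 al be Hab (fun v Hv => proj2 (proj1 (Hc v Hv)))) as [B1 [PB1 HB1]].
  destruct (Ccont_bounded dc2 al be Hab (fun v Hv => proj2 (proj2 (Hc v Hv)))) as [B2 [PB2 HB2]].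
  assert (CD : forall c dc, (forall v, al <= v <= be -> is_arc c dc v) ->
     exists B, 0 < B /\ forall v, al <= v <= be -> Cmod (c v - a)%C <= B).
  { intros c dc Hcd. apply (Ccont_bounded (fun v => c v - a)%C al be Hab). intros v Hv.
    eapply is_Cderive_cont. apply is_Cderive_minus; [apply (Hcd v Hv) | apply is_Cderive_const]. }
  destruct (CD c1 dc1 (fun v Hv => proj1 (Hc v Hv))) as [D1 [PD1 HD1]].
  destruct (CD c2 dc2 (fun v Hv => proj2 (Hc v Hv))) as [D2 [PD2 HD2]].
  rewrite (winding_integral_const k a c1 dc1 c2 dc2 al be Hab Hc E1 E2 NW).
  match goal with |- ?X = ?Y => set (x := X); set (y := Y) end.
  assert (Z : (x - y)%C = RtoC 0).
  { apply Ceq0_of_small. intros eps Heps.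
    (* The two integrals differ by at most G s; s is chosen accordingly, and so small that
       the contracted contour stays where the estimate at the pole holds. *)
    set (G := 2 * (be - al) * ((B1 + B2) * L) + 1).
    assert (PBL : 0 < (B1 + B2) * L) by (apply Rmult_lt_0_compat; lra).
    assert (PG : 0 < G).
    { unfold G. assert (0 <= 2 * (be - al) * ((B1 + B2) * L)); [| lra].
      apply Rmult_le_pos; lra. }
    set (s := Rmin 1 (Rmin (eta / (D1 + D2)) (eps / G))).
    assert (Ps : 0 < s) by (unfold s; repeat apply Rmin_pos; try apply Rdiv_lt_0_compat; lra).
    assert (s <= 1 /\ s <= eta / (D1 + D2) /\ s <= eps / G) as (S1 & S2 & S3).
    { unfold s; repeat split; [apply Rmin_l | eapply Rle_trans; [apply Rmin_r | apply Rmin_l]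
        | eapply Rle_trans; [apply Rmin_r | apply Rmin_r]]. }
    assert (S2' : s * (D1 + D2) <= eta).
    { apply Rle_trans with (eta / (D1 + D2) * (D1 + D2)); [apply Rmult_le_compat_r; lra | right; field; lra]. }
    assert (S3' : s * G <= eps).
    { apply Rle_trans with (eps / G * G); [apply Rmult_le_compat_r; lra | right; field; lra]. }
    unfold x. rewrite <- (contracted_integral_const a c1 dc1 c2 dc2 al be s Hab S1 Hc E1 E2)
      by (intros; apply N; [lra | assumption]).
    assert (CK : forall v, al <= v <= be -> Ccont (contracted_form a c1 dc1 s) v /\ Ccont (contracted_form a c2 dc2 s) v
       /\ Ccont (winding_form k a c1 dc1 1) v /\ Ccont (winding_form k a c2 dc2 1) v).
    { intros v Hv. destruct (Hc v Hv), (N s v ltac:(lra) Hv), (NW 1 v ltac:(lra) Hv).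
      repeat split; apply (Ccont2_slice (fun s v => _ s v)); 
        [apply Ccont2_contracted_form | apply Ccont2_contracted_form | apply Ccont2_contracted_form | apply Ccont2_contracted_form
        | apply Ccont2_winding_form | apply Ccont2_winding_form| apply Ccont2_winding_form| apply Ccont2_winding_form]; assumption. }
    unfold y. rewrite <- CInt_minus; try assumption;
      try (intros v Hv; destruct (CK v Hv) as (? & ? & ? & ?); apply Ccont_minus; assumption).
    eapply Rle_trans; [apply CInt_bound with (M := (B1 + B2) * L * s); [exact Hab | |] |].
    - intros v Hv; destruct (CK v Hv) as (? & ? & ? & ?); apply Ccont_minus; apply Ccont_minus; assumption.
    - intros v Hv.
      assert (T : forall c dc B D, c v <> a -> Cmod (dc v) <= B -> Cmod (c v - a) <= D -> 0 < D -> D <= D1 + D2 ->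
         Cmod (contracted_form a c dc s v - winding_form k a c dc 1 v)%C <= B * (L * s)).
      { intros c dc B D Hne HB HD PD HDD.
        replace (contracted_form a c dc s v - winding_form k a c dc 1 v)%C
          with (dc v * (RtoC s * / contracted_den a s (c v) - k * / (c v - a)))%C.
        2:{ unfold contracted_form, winding_form. replace (c v - RtoC 1 * a)%C with (c v - a)%C by ring. ring. }
        rewrite Cmod_mult. apply Rmult_le_compat; try apply Cmod_ge_0; [exact HB |].
        apply HL; [exact Ps | exact Hne |].
        apply Rle_trans with (s * (D1 + D2)); [apply Rmult_le_compat_l; lra | exact S2']. }
      destruct (NW1 v Hv) as [A1 A2].
      generalize (T c1 dc1 B1 D1 A1 (HB1 v Hv) (HD1 v Hv) PD1 ltac:(lra)).
      generalize (T c2 dc2 B2 D2 A2 (HB2 v Hv) (HD2 v Hv) PD2 ltac:(lra)). intros T2 T1.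
      match goal with |- Cmod ?e <= _ =>
        replace e with ((contracted_form a c1 dc1 s v - winding_form k a c1 dc1 1 v)
          + - (contracted_form a c2 dc2 s v - winding_form k a c2 dc2 1 v))%C by ring end.
      eapply Rle_trans; [apply Cmod_triangle |]. rewrite Cmod_opp. lra.
    - apply Rle_trans with (s * G); [| exact S3'].
      unfold G. assert (0 < s) by lra. nra. }
  replace x with (x - y + y)%C by ring. rewrite Z. ring.
Qed.

Definition boundary (v : R) : C := (xcot v, v).
Definition dboundary (v : R) : C := (dxcot v, 1).
Definition phi (v : R) : R := sinc v * exp (xcot v).

Lemma is_arc_boundary v : Rabs v < PI -> is_arc boundary dboundary v.
Proof.
  intros H; split; split; simpl.
  - apply xcot_derive, H.
  - apply (@is_derive_id R_AbsRing).
  - apply dxcot_cont, H.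
  - apply continuity_pt_const. intros x y; reflexivity.
Qed.

Lemma is_arc_segment x v : is_arc (fun v => (x, v)) (fun _ => Ci) v.
Proof.
  split; split; simpl.
  - apply (@is_derive_const R_AbsRing R_NormedModule).
  - apply (@is_derive_id R_AbsRing).
  - apply continuity_pt_const. intros a b; reflexivity.
  - apply continuity_pt_const. intros a b; reflexivity.
Qed.

Lemma phi_pos v : Rabs v < PI -> 0 < phi v.
Proof. intros H; apply Rmult_lt_0_compat; [apply sinc_pos, H | apply exp_pos]. Qed.

Lemma phi_cont v : Rabs v < PI -> continuity_pt phi v.
Proof.
  intros H. unfold phi. apply continuity_pt_mult; [apply sinc_cont |].
  apply (continuity_pt_comp xcot exp); [apply xcot_cont, H |].
  apply derivable_continuous_pt, derivable_pt_exp.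
Qed.

(** The reason for the choice of the curve: e^w / w is real along it. *)
Lemma Cexp_boundary v : Rabs v < PI -> Cexp (boundary v) = (RtoC (phi v) * boundary v)%C.
Proof.
  intros H. generalize (wexp_boundary v H) (phi_pos v H) (sinc_pos v H); intros E P Q.
  fold (boundary v) in E.
  assert (E2 : wexp (boundary v) = (/ RtoC (phi v))%C).
  { rewrite E. rewrite <- RtoC_inv by lra. f_equal. unfold phi. rewrite exp_Ropp.
    generalize (exp_pos (xcot v)); intros. field. lra. }
  assert (N : RtoC (phi v) <> RtoC 0) by (intros F; apply RtoC_inj in F; lra).
  transitivity (Cexp (boundary v) * (RtoC (phi v) * / RtoC (phi v)))%C; [rewrite Cinv_r by exact N; ring |].
  rewrite <- E2. unfold wexp.
  transitivity (RtoC (phi v) * boundary v * (Cexp (boundary v) * Cexp (- boundary v)))%C; [ring |].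
  rewrite Cexp_opp_r. ring.
Qed.

Lemma contracted_den_1 a c : contracted_den a 1 c = (c - wexp a * Cexp c)%C.
Proof.
  unfold contracted_den, wexp.
  replace (RtoC 1 * (c - a))%C with (c + - a)%C by ring. rewrite Cexp_plus. ring.
Qed.

Lemma contracted_den_boundary a v :
  Rabs v < PI -> contracted_den a 1 (boundary v) = (boundary v * (RtoC 1 - wexp a * RtoC (phi v)))%C.
Proof. intros H. rewrite contracted_den_1, Cexp_boundary by exact H. ring. Qed.

Lemma boundary_neq0 v : Rabs v < PI -> boundary v <> RtoC 0.
Proof.
  intros H E. apply (Cexp_neq0 (boundary v)). rewrite Cexp_boundary by exact H. rewrite E. ring.
Qed.

(** The logarithmic derivative of e^(i v) / sinc v. Its real part is odd in v. *)
Lemma dboundary_eq v :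
  Rabs v < PI -> dboundary v = (boundary v * (Ci - RtoC (dsinc v / sinc v)))%C.
Proof.
  intros H. generalize (sinc_pos v H); intros P. apply injective_projections; simpl.
  - unfold dxcot, xcot. rewrite (sin_eq_sinc v). field. lra.
  - generalize (dsinc_eq v); unfold xcot; intros E.
    transitivity ((cos v - v * dsinc v) / sinc v); [| field; lra].
    rewrite E. field. lra.
Qed.

Lemma phi_even v : phi (- v) = phi v.
Proof. unfold phi. rewrite sinc_even, xcot_even. reflexivity. Qed.

Lemma Omega_neq1 a : Omega a -> (RtoC 1 - a)%C <> RtoC 0.
Proof.
  intros [H1 H2] E. assert (F : a = RtoC 1) by (replace a with (RtoC 1 - (RtoC 1 - a))%C by ring; rewrite E; ring).
  rewrite F in H2. simpl in H2. rewrite xcot_0 in H2. lra.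
Qed.

(** By convexity the contracted point stays in the closed domain, and there a is the only
    zero by injectivity. *)
Lemma contracted_den_neq0 a c s :
  Omega a -> (Im (wexp a) <> 0 \/ Re (wexp a) < 0) -> Omega_cl c -> c <> a -> 0 < s <= 1 ->
  contracted_den a s c <> RtoC 0.
Proof.
  intros Ha Hn Hc Hne Hs.
  set (w := (a + RtoC s * (c - a))%C).
  replace (contracted_den a s c) with (w - a * Cexp (w - a))%C.
  2:{ unfold contracted_den, w. replace (a + RtoC s * (c - a) - a)%C with (RtoC s * (c - a))%C by ring. reflexivity. }
  apply shifted_den_neq0; auto.
  - apply Omega_cl_segment; auto; lra.
  - intros E. assert (F : (RtoC s * (c - a))%C = RtoC 0).
    { replace (RtoC s * (c - a))%C with (w - a)%C by (unfold w; ring). rewrite E; ring. }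
    revert F. apply Cmult_neq_0.
    + intros F; apply RtoC_inj in F; lra.
    + intros F; apply Hne. replace c with (c - a + a)%C by ring. rewrite F; ring.
Qed.

(** The domain is star-shaped about 0, so the segment from 0 to a does not meet the curve. *)
Lemma boundary_neq_scaled a t v : Omega a -> 0 <= t <= 1 -> Rabs v < PI -> (boundary v - RtoC t * a)%C <> RtoC 0.
Proof.
  intros [H1 H2] Ht Hv E.
  assert (F : boundary v = (RtoC t * a)%C) by (replace (boundary v) with (boundary v - RtoC t * a + RtoC t * a)%C by ring; rewrite E; ring).
  assert (F1 : xcot v = t * Re a) by (apply (f_equal Re) in F; simpl in F; unfold Re; lra).
  assert (F2 : v = t * Im a) by (apply (f_equal Im) in F; simpl in F; unfold Im; lra).
  destruct (xcot_concave t 0 (Im a) Ht) as [_ C]; [rewrite Rabs_R0; apply PI_RGT_0 | exact H1 |].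
  rewrite xcot_0 in C.
  replace ((1 - t) * 0 + t * Im a) with v in C by lra.
  generalize (convex_pos t 1 (xcot (Im a) - Re a) Ht ltac:(lra) ltac:(lra)). lra.
Qed.

(** The residue identity for the curve over [- V, V], closed by the segment with abscissa
    xcot V. The condition xcot V < Re a puts a inside the contour. The left-hand side is
    what the curve contributes after folding v onto - v; the right-hand side is what
    the segment contributes. *)
Lemma truncated_contour a V :
  Omega a -> (Im (wexp a) <> 0 \/ Re (wexp a) < 0) ->
  0 < V < PI -> xcot V < 0 -> xcot V < Re a ->
  let B v := (Ci * / contracted_den a 1 (xcot V, v) - / (RtoC 1 - a) * Ci * / (xcot V, v))%C in
  (forall v, - V <= v <= V -> Ccont B v) /\
  CInt (fun v => 2 * Ci * (/ (RtoC 1 - wexp a * RtoC (phi v)) - / (RtoC 1 - a)))%C 0 V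
  = CInt B (- V) V.
Proof.
  intros Ha Hn HV Hx0 Hxa B. set (k := (/ (RtoC 1 - a))%C) in *.
  assert (AV : forall v, - V <= v <= V -> Rabs v < PI) by (intros v Hv; apply Rabs_def1; lra).
  set (seg := (fun v => (xcot V, v)) : R -> C).
  assert (Harc : forall v, - V <= v <= V -> is_arc boundary dboundary v /\ is_arc seg (fun _ => Ci) v).
  { intros v Hv; split; [apply is_arc_boundary, AV, Hv | apply is_arc_segment]. }
  assert (N : forall s v, 0 < s <= 1 -> - V <= v <= V ->
     contracted_den a s (boundary v) <> RtoC 0 /\ contracted_den a s (seg v) <> RtoC 0).
  { intros s v Hs Hv. split; apply contracted_den_neq0; auto.
    - split; simpl; [apply AV, Hv | lra].
    - intros E. destruct Ha as [_ Ha]. rewrite <- E in Ha. simpl in Ha. lra.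
    - split; simpl; [apply AV, Hv | apply xcot_min; assumption].
    - intros E. rewrite <- E in Hxa. simpl in Hxa. lra. }
  assert (NW : forall t v, 0 <= t <= 1 -> - V <= v <= V ->
     (boundary v - RtoC t * a)%C <> RtoC 0 /\ (seg v - RtoC t * a)%C <> RtoC 0).
  { intros t v Ht Hv. split; [apply boundary_neq_scaled; auto |].
    intros E. apply (f_equal Re) in E.
    assert (E' : xcot V = t * Re a) by (simpl in E; unfold Re; lra).
    destruct (Rle_lt_dec 0 (Re a)); nra. }
  assert (Hone : forall v, - V <= v <= V -> (RtoC 1 - wexp a * RtoC (phi v))%C <> RtoC 0).
  { intros v Hv E. apply (proj1 (N 1 v ltac:(lra) Hv)). rewrite contracted_den_boundary by auto. rewrite E; ring. }
  generalize (residue_at_pole a boundary dboundary seg (fun _ => Ci) (- V) V ltac:(lra) (Omega_neq1 a Ha) Harc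
    ltac:(unfold boundary, seg; rewrite xcot_even; reflexivity) eq_refl N NW). fold k. intros R.
  (* The integrand on the curve, after subtracting dw / ((1 - a) w); the term with dsinc is
     odd. *)
  set (A := fun v => ((Ci - RtoC (dsinc v / sinc v)) * (/ (RtoC 1 - wexp a * RtoC (phi v)) - k))%C).
  assert (CB : forall v, - V <= v <= V -> Ccont B v).
  { intros v Hv.
    assert (X : Ccont (fun v => contracted_form a seg (fun _ => Ci) 1 v - winding_form k a seg (fun _ => Ci) 0 v)%C v).
    { apply (Ccont2_slice (fun t v => contracted_form a seg (fun _ => Ci) 1 v - winding_form k a seg (fun _ => Ci) 0 v)%C 0 v).
      apply Ccont2_minus; apply Ccont2_snd;
      [apply (Ccont2_slice (contracted_form a seg (fun _ => Ci))), Ccont2_contracted_form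
      | apply (Ccont2_slice (winding_form k a seg (fun _ => Ci))), Ccont2_winding_form].
      - apply Harc, Hv. - apply N; [lra | exact Hv]. - apply Harc, Hv. - apply NW; [lra | exact Hv]. }
    assert (EB : forall v, (contracted_form a seg (fun _ => Ci) 1 v - winding_form k a seg (fun _ => Ci) 0 v)%C = B v).
    { intros u. unfold contracted_form, winding_form, B. fold (seg u).
      replace (seg u - RtoC 0 * a)%C with (seg u) by ring. ring. }
    exact (Ccont_ext _ _ _ EB X). }
  split; [exact CB |].
  assert (CA : forall v, - V <= v <= V -> Ccont A v).
  { intros v Hv. apply (Ccont2_slice (fun _ v => A v) 0 v). unfold A.
    assert (P : Ccont2 (fun _ v => RtoC (phi v)) 0 v).
    { apply Ccont2_snd. split; simpl.
      - apply continuity_pt_mult; [apply sinc_cont |].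
        apply (continuity_pt_comp xcot exp); [apply xcot_cont, AV, Hv |].
        apply derivable_continuous_pt, derivable_pt_exp.
      - apply continuity_pt_const; intros x y; reflexivity. }
    apply Ccont2_mult.
    - apply Ccont2_minus; [apply Ccont2_const |]. apply Ccont2_snd; split; simpl.
      + apply continuity_pt_div; [apply dsinc_cont | apply sinc_cont |].
        generalize (sinc_pos v (AV v Hv)); lra.
      + apply continuity_pt_const; intros x y; reflexivity.
    - apply Ccont2_minus; [| apply Ccont2_const].
      apply (Ccont2_inv (fun _ v => RtoC 1 - wexp a * RtoC (phi v))%C); [| apply Hone, Hv].
      apply Ccont2_minus; [apply Ccont2_const |]. apply Ccont2_mult; [apply Ccont2_const | exact P]. }
  assert (EAB : CInt (fun v => A v - B v)%C (- V) V = RtoC 0).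
  { match type of R with ?X = ?Y => assert (R2 : (X - Y)%C = RtoC 0) by (rewrite R; ring) end.
    rewrite <- CInt_minus in R2; [| lra | |].
    - rewrite <- R2. apply CInt_ext; [lra |]. intros v Hv.
      assert (Hv' : - V <= v <= V) by lra.
      unfold A, B, contracted_form, winding_form.
      rewrite contracted_den_boundary by auto. rewrite (dboundary_eq v) by auto.
      fold (seg v). set (l := RtoC (dsinc v / sinc v)).
      replace (seg v - RtoC 0 * a)%C with (seg v) by ring.
      replace (boundary v - RtoC 0 * a)%C with (boundary v) by ring.
      generalize (Hone v Hv') (boundary_neq0 v (AV v Hv')); intros Q1 Q2.
      set (iseg := (/ seg v)%C). set (iden := (/ contracted_den a 1 (seg v))%C).
      clearbody iseg iden. field. split; assumption.
    - intros v Hv. destruct (Harc v Hv), (N 1 v ltac:(lra) Hv).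
      apply (Ccont2_slice (fun s v => contracted_form a boundary dboundary s v - contracted_form a seg (fun _ => Ci) s v)%C 1 v).
      apply Ccont2_minus; apply Ccont2_contracted_form; assumption.
    - intros v Hv. destruct (Harc v Hv), (NW 0 v ltac:(lra) Hv).
      apply (Ccont2_slice (fun s v => winding_form k a boundary dboundary s v - winding_form k a seg (fun _ => Ci) s v)%C 0 v).
      apply Ccont2_minus; apply Ccont2_winding_form; assumption. }
  rewrite CInt_minus in EAB by (try lra; assumption).
  transitivity (CInt A (- V) V).
  - rewrite CInt_symmetric by (try lra; assumption). apply CInt_ext; [lra |]. intros v Hv.
    unfold A. rewrite phi_even, sinc_even, dsinc_odd.
    replace (- dsinc v / sinc v) with (- (dsinc v / sinc v)) by (unfold Rdiv; ring).
    rewrite RtoC_opp. set (l := RtoC (dsinc v / sinc v)). ring.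
  - replace (CInt A (- V) V) with (CInt A (- V) V - CInt B (- V) V + CInt B (- V) V)%C by ring.
    rewrite EAB. ring.
Qed.

(** * The slit plane *)

(** The plane without the closed negative real axis. *)
Definition slit (z : C) : Prop := Im z <> 0 \/ 0 < Re z.

Lemma slit_neq0 z : slit z -> z <> RtoC 0.
Proof. intros [H|H] E; rewrite E in H; simpl in H; lra. Qed.

Lemma slit_scal t z : 0 < t -> slit z -> slit (RtoC t * z)%C.
Proof.
  intros Ht Hz. unfold slit.
  replace (Im (RtoC t * z)%C) with (t * Im z) by (simpl; unfold Im; ring).
  replace (Re (RtoC t * z)%C) with (t * Re z) by (simpl; unfold Re; ring).
  destruct Hz as [H|H]; [left; apply Rmult_integral_contrapositive; split; lra | right; nra].
Qed.

Lemma slit_one_plus r z : 0 <= r -> slit z -> slit (RtoC 1 + z * RtoC r)%C.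
Proof.
  intros Hr Hz. unfold slit.
  replace (Im (RtoC 1 + z * RtoC r)%C) with (r * Im z) by (simpl; unfold Im; ring).
  replace (Re (RtoC 1 + z * RtoC r)%C) with (1 + r * Re z) by (simpl; unfold Re; ring).
  destruct Hr as [Hr| <-].
  - destruct Hz as [H|H]; [left; apply Rmult_integral_contrapositive; split; lra | right; nra].
  - right; lra.
Qed.

(** * From the truncated contour to the whole curve *)

(** Continuous on the whole line, which makes all integrals up to the end point pi proper. *)
Definition phi_ext (v : R) : R := if Rlt_dec (Rabs v) PI then phi v else 0.

Lemma phi_ext_eq v : Rabs v < PI -> phi_ext v = phi v.
Proof. intros H; unfold phi_ext; destruct Rlt_dec; [reflexivity | contradiction]. Qed.

Lemma phi_ext_nonneg v : 0 <= phi_ext v.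
Proof. unfold phi_ext; destruct Rlt_dec; [left; apply phi_pos; assumption | lra]. Qed.

(** At v = pi and v = - pi the factor sinc tends to 0 and the exponential is at most 1, since
    its exponent is negative near these points. *)
Lemma phi_ext_cont v : continuity_pt phi_ext v.
Proof.
  destruct (Rtotal_order (Rabs v) PI) as [L|[L|L]].
  - apply continuity_pt_ext_loc with phi; [| apply phi_cont, L].
    assert (P : 0 < PI - Rabs v) by lra. exists (mkposreal _ P). intros u Hu.
    symmetry; apply phi_ext_eq. change (Rabs (u - v) < PI - Rabs v) in Hu.
    generalize (Rabs_triang_inv u v). lra.
  - destruct (sinc_at_PI v L) as [S Cv].
    apply continuity_pt_locally. intros eps.
    destruct (proj1 (continuity_pt_locally sinc v) (sinc_cont v) eps) as [d1 H1].
    destruct (proj1 (continuity_pt_locally cos v) (continuity_cos v) (mkposreal 1 Rlt_0_1)) as [d2 H2].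
    assert (P : 0 < Rmin d1 d2) by (apply Rmin_pos; apply cond_pos).
    exists (mkposreal _ P). intros u Hu. change (Rabs (u - v) < Rmin d1 d2) in Hu.
    specialize (H1 u (Rlt_le_trans _ _ _ Hu (Rmin_l _ _))).
    specialize (H2 u (Rlt_le_trans _ _ _ Hu (Rmin_r _ _))). simpl in H2.
    rewrite Cv in H2. rewrite S in H1. apply Rabs_def2 in H2. apply Rabs_def2 in H1.
    unfold phi_ext at 2. destruct (Rlt_dec (Rabs v) PI); [lra |]. unfold phi_ext. destruct (Rlt_dec (Rabs u) PI) as [Q|Q].
    + generalize (sinc_pos u Q) (phi_pos u Q); intros Ps Pp.
      assert (X : exp (xcot u) <= 1).
      { rewrite <- exp_0. left; apply exp_increasing. unfold xcot.
        apply Rmult_lt_reg_r with (sinc u); [exact Ps |].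
        unfold Rdiv. rewrite Rmult_assoc, Rinv_l; lra. }
      assert (phi u <= sinc u) by (unfold phi; nra).
      apply Rabs_def1; lra.
    + rewrite Rminus_eq_0, Rabs_R0. apply cond_pos.
  - apply continuity_pt_ext_loc with (fun _ => 0).
    + assert (P : 0 < Rabs v - PI) by lra. exists (mkposreal _ P). intros u Hu.
      change (Rabs (u - v) < Rabs v - PI) in Hu. unfold phi_ext. destruct Rlt_dec; [| reflexivity].
      generalize (Rabs_triang_inv v u). rewrite <- Rabs_Ropp in Hu.
      replace (- (u - v)) with (v - u) in Hu by ring. lra.
    + apply continuity_pt_const; intros x y; reflexivity.
Qed.

Lemma Ccont2_phi_ext s v : Ccont2 (fun _ v => RtoC (phi_ext v)) s v.
Proof.
  apply Ccont2_snd; split; simpl; [apply phi_ext_cont |].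
  apply continuity_pt_const; intros x y; reflexivity.
Qed.

Lemma Ccont_resolvent y k v :
  slit (- y)%C -> Ccont (fun v => / (RtoC 1 - y * RtoC (phi_ext v)) - k)%C v.
Proof.
  intros H. apply (Ccont2_slice (fun _ v => / (RtoC 1 - y * RtoC (phi_ext v)) - k)%C 0 v).
  apply Ccont2_minus; [| apply Ccont2_const].
  apply (Ccont2_inv (fun _ v => RtoC 1 - y * RtoC (phi_ext v))%C).
  - apply Ccont2_minus; [apply Ccont2_const |].
    apply Ccont2_mult; [apply Ccont2_const | apply Ccont2_phi_ext].
  - replace (RtoC 1 - y * RtoC (phi_ext v))%C with (RtoC 1 + - y * RtoC (phi_ext v))%C by ring.
    apply slit_neq0, slit_one_plus; [apply phi_ext_nonneg | exact H].
Qed.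

(** On the segment both denominators grow like - xcot V, so its contribution tends to 0 as
    V tends to pi; the integral of the curve part is continuous in V. *)
Lemma resolvent_integral a :
  Omega a -> slit (- wexp a)%C ->
  CInt (fun v => / (RtoC 1 - wexp a * RtoC (phi_ext v)) - / (RtoC 1 - a))%C 0 PI = RtoC 0.
Proof.
  intros Ha Hs. generalize PI_RGT_0; intros Ppi.
  assert (Hn : Im (wexp a) <> 0 \/ Re (wexp a) < 0).
  { destruct Hs as [H|H]; [left; change (- Im (wexp a) <> 0) in H | right; change (0 < - Re (wexp a)) in H]; lra. }
  set (k := (/ (RtoC 1 - a))%C).
  set (h := fun v => (/ (RtoC 1 - wexp a * RtoC (phi_ext v)) - k)%C).
  assert (Ch : forall v, Ccont h v) by (intros v; apply Ccont_resolvent, Hs).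
  set (h2 := fun v => (2 * Ci * h v)%C).
  assert (Ch2 : forall v, Ccont h2 v).
  { intros v. apply (Ccont2_slice (fun _ v => 2 * Ci * h v)%C 0 v).
    apply Ccont2_mult; [apply Ccont2_const | apply Ccont2_snd, Ch]. }
  assert (Z : CInt h2 0 PI = RtoC 0).
  { apply Ceq0_of_small. intros eps Heps.
    destruct (Ccont_bounded h2 0 PI ltac:(lra) ltac:(intros; apply Ch2)) as [b [Pb Hb]].
    set (K := 2 + Cmod k).
    assert (PK : 0 < K) by (generalize (Cmod_ge_0 k); unfold K; lra).
    (* The first summand makes the denominator on the segment at least half of - xcot V, the
       second puts a to the right of the segment, and the last one bounds the contribution
       of the segment by eps / 2. *)
    set (A := 2 * Cmod (wexp a) + Rabs (Re a) + 1 + 8 * PI * K / eps).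
    assert (PA4 : 0 < 8 * PI * K / eps).
    { apply Rdiv_lt_0_compat; [| lra]. apply Rmult_lt_0_compat; lra. }
    destruct (xcot_minus_infty A) as [V0 [HV0 HX]].
    set (V := Rmax ((V0 + PI) / 2) (PI - eps / (4 * b))).
    assert (Peb : 0 < eps / (4 * b)) by (apply Rdiv_lt_0_compat; lra).
    assert (HV : V0 < V < PI).
    { unfold V; split; [eapply Rlt_le_trans; [| apply Rmax_l]; lra | apply Rmax_lub_lt; lra]. }
    assert (HVb : 2 * (PI - V) * b <= eps / 2).
    { assert (PI - V <= eps / (4 * b)) by (generalize (Rmax_r ((V0 + PI) / 2) (PI - eps / (4 * b))); fold V; lra).
      apply Rle_trans with (2 * (eps / (4 * b)) * b); [| right; field; lra].
      apply Rmult_le_compat_r; lra. }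
    specialize (HX V HV). set (X := - xcot V).
    assert (HXA : A < X) by (unfold X; lra).
    assert (M0 : 0 <= Cmod (wexp a)) by apply Cmod_ge_0.
    generalize (Rabs_pos (Re a)) (Rle_abs (- Re a)). rewrite Rabs_Ropp. intros R0 R1.
    assert (PX : 0 < X) by (unfold A in HXA; lra).
    destruct (truncated_contour a V Ha Hn ltac:(lra) ltac:(unfold X in PX; lra) ltac:(unfold A, X in HXA; lra)) as [CB E].
    cbv zeta in CB, E.
    rewrite (CInt_Chasles h2 0 V PI) by (try lra; intros; apply Ch2).
    eapply Rle_trans; [apply Cmod_triangle |].
    replace eps with (eps / 2 + eps / 2) by field. apply Rplus_le_compat.
    - rewrite (CInt_ext h2 (fun v => 2 * Ci * (/ (RtoC 1 - wexp a * RtoC (phi v)) - / (RtoC 1 - a)))%C 0 V).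
      2: lra.
      2:{ intros v Hv. unfold h2, h, k. rewrite phi_ext_eq; [reflexivity | apply Rabs_def1; lra]. }
      rewrite E.
      eapply Rle_trans; [apply CInt_bound with (M := K / X); [lra | exact CB |] |].
      + intros v Hv. set (sg := (xcot V, v) : C).
        change (Cmod (Ci * / contracted_den a 1 sg - k * Ci * / sg)%C <= K / X).
        assert (Msg : X <= Cmod sg).
        { eapply Rle_trans; [| apply re_le_Cmod]. unfold X, sg; simpl. generalize (Rle_abs (- xcot V)). rewrite Rabs_Ropp. lra. }
        assert (Nsg : sg <> RtoC 0) by (apply Cmod_gt_0; lra).
        assert (Md : X / 2 <= Cmod (contracted_den a 1 sg)).
        { rewrite contracted_den_1.
          assert (T : Cmod sg <= Cmod (sg - wexp a * Cexp sg) + Cmod (wexp a) * Cmod (Cexp sg)).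
          { rewrite <- Cmod_mult. replace sg with (sg - wexp a * Cexp sg + wexp a * Cexp sg)%C at 1 by ring. apply Cmod_triangle. }
          rewrite Cmod_Cexp in T. simpl in T.
          assert (exp (xcot V) <= 1) by (rewrite <- exp_0; left; apply exp_increasing; unfold X in PX; lra).
          assert (Cmod (wexp a) * exp (xcot V) <= Cmod (wexp a) * 1) by (apply Rmult_le_compat_l; assumption).
          unfold A in HXA. lra. }
        assert (Nd : contracted_den a 1 sg <> RtoC 0) by (apply Cmod_gt_0; lra).
        assert (MC : Cmod Ci = 1) by (rewrite <- sqrt_1; unfold Cmod, Ci; simpl; f_equal; ring).
        eapply Rle_trans; [apply Cmod_triangle |]. rewrite Cmod_opp, !Cmod_mult, !Cmod_inv, MC by assumption.
        unfold K.
        assert (I1 : / Cmod (contracted_den a 1 sg) <= / (X / 2)) by (apply Rinv_le_contravar; lra).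
        assert (I2 : / Cmod sg <= / X) by (apply Rinv_le_contravar; lra).
        replace (/ (X / 2)) with (2 * / X) in I1 by (field; lra).
        assert (Cmod k * / Cmod sg <= Cmod k * / X) by (apply Rmult_le_compat_l; [apply Cmod_ge_0 | exact I2]).
        unfold Rdiv. lra.
      + assert (PXi : 0 < / X) by (apply Rinv_0_lt_compat, PX).
        apply Rle_trans with (4 * PI * K * / X).
        * unfold Rdiv. assert (0 < K * / X) by (apply Rmult_lt_0_compat; assumption). nra.
        * apply Rmult_le_reg_r with X; [exact PX |]. rewrite Rmult_assoc, Rinv_l by lra.
          assert (8 * PI * K / eps < X) by (unfold A in HXA; lra).
          apply Rle_trans with (eps / 2 * (8 * PI * K / eps)); [right; field; lra |].
          apply Rmult_le_compat_l; lra.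
    - eapply Rle_trans; [apply CInt_bound with (M := b); [lra | intros; apply Ch2 | intros; apply Hb; lra] |].
      exact HVb. }
  unfold h2 in Z. rewrite CInt_scal in Z by (try lra; intros; apply Ch).
  assert (NC : (2 * Ci)%C <> RtoC 0).
  { intros F. apply (f_equal Im) in F. simpl in F. lra. }
  destruct (Ceq_dec (CInt h 0 PI) (RtoC 0)) as [E|E]; [exact E |].
  exfalso; exact (Cmult_neq_0 _ _ NC E Z).
Qed.

(** * The principal logarithm on the slit plane *)

Lemma slit_half_angle z : slit z -> 0 < Cmod z + Re z.
Proof.
  intros H. generalize (Cmod2_alt z) (Cmod_ge_0 z) (Cmod_gt_0 z) (slit_neq0 z H); intros E P [Q _] N.
  specialize (Q N). destruct H as [H|H]; [| lra].
  generalize (pow2_gt_0 _ H); intros.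
  destruct (Rlt_le_dec 0 (Cmod z + Re z)) as [L|L]; [exact L | nra].
Qed.

(** The half-angle formula gives the argument as one smooth expression on the slit plane,
    while the definition by cases uses arccos, which is not differentiable on the positive
    real axis. *)
Lemma Carg_atan z : slit z -> Carg z = 2 * atan (Im z / (Cmod z + Re z)).
Proof.
  intros H. generalize (slit_half_angle z H) (slit_neq0 z H); intros P N.
  generalize (proj1 (Cmod_gt_0 z) N) (Cmod2_alt z); intros Pm E2.
  set (r := Cmod z) in *. set (x := Re z) in *. set (y := Im z) in *.
  set (q := y / (r + x)). set (th := atan q).
  assert (Cth : cos (2 * th) = x / r).
  { generalize (atan_bound q); fold th; intros [B1 B2].
    assert (Cp : 0 < cos th) by (apply cos_gt_0; lra).
    assert (S : sin th = q * cos th).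
    { unfold th. rewrite <- (tan_atan q) at 2. unfold tan. fold th. field. lra. }
    assert (Q : cos th * cos th * (1 + q * q) = 1).
    { generalize (sin2_cos2 th); unfold Rsqr; rewrite S; intros E; etransitivity; [| exact E]; ring. }
    rewrite cos_2a, S.
    assert (Q1 : 0 < 1 + q * q) by nra.
    apply Rmult_eq_reg_r with (1 + q * q); [| lra].
    transitivity (cos th * cos th * (1 + q * q) * (1 - q * q)); [ring |]. rewrite Q, Rmult_1_l.
    assert (Qq : q * q = (r - x) / (r + x)).
    { transitivity (y ^ 2 / (r + x) ^ 2); [unfold q; field; lra |].
      replace (y ^ 2) with ((r - x) * (r + x)) by (ring_simplify; lra). field; lra. }
    rewrite Qq. field. lra. }
  unfold Carg. fold x y r. rewrite <- Cth.
  generalize (atan_bound q); fold th; intros [B1 B2].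
  destruct (Rlt_dec y 0) as [L|L].
  - assert (th < 0).
    { unfold th. rewrite <- atan_0. apply atan_increasing. unfold q.
      apply Rmult_lt_reg_r with (r + x); [exact P |]. unfold Rdiv. rewrite Rmult_assoc, Rinv_l; lra. }
    replace (2 * th) with (- (2 * - th)) at 1 by ring. rewrite cos_neg, acos_cos; lra.
  - assert (0 <= th).
    { unfold th. rewrite <- atan_0. destruct (Rle_lt_dec q 0) as [L2|L2].
      - replace q with 0; [lra |]. apply Rle_antisym; [| exact L2].
        unfold q. apply Rdiv_le_0_compat; lra.
      - left; apply atan_increasing, L2. }
    apply acos_cos; lra.
Qed.

Lemma slit_open f x y : Ccont2 f x y -> slit (f x y) -> locally_2d (fun s v => slit (f s v)) x y.
Proof.
  intros H [S|S].
  - destruct (continuity_2d_pt_neq_0 _ _ _ (proj2 H) S) as [d Hd]. exists d; intros; left; auto.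
  - destruct (proj1 H (mkposreal _ S)) as [d Hd]. exists d; intros u v Hu Hv. right.
    specialize (Hd u v Hu Hv). simpl in Hd. apply Rabs_def2 in Hd. lra.
Qed.

Lemma Ccont2_Cln f x y : Ccont2 f x y -> slit (f x y) -> Ccont2 (fun s v => Cln (f s v)) x y.
Proof.
  intros H S. generalize (slit_half_angle _ S) (proj1 (Cmod_gt_0 _) (slit_neq0 _ S)); intros P Pm.
  assert (M : continuity_2d_pt (fun s v => Cmod (f s v)) x y).
  { apply (continuity_1d_2d_pt_comp sqrt (fun s v => Re (f s v) ^ 2 + Im (f s v) ^ 2)).
    - apply continuity_pt_sqrt. generalize (Cnorm2_pos _ (slit_neq0 _ S)). lra.
    - apply Ccont2_norm2, H. }
  split; simpl.
  - apply (continuity_1d_2d_pt_comp ln (fun s v => Cmod (f s v))); [| exact M].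
    eapply is_derive_continuity_pt, is_derive_ln, Pm.
  - apply continuity_2d_pt_ext_loc with (fun s v => 2 * atan (Im (f s v) / (Cmod (f s v) + Re (f s v)))).
    + destruct (slit_open f x y H S) as [d Hd]. exists d; intros u v Hu Hv. symmetry; apply Carg_atan, Hd; assumption.
    + apply continuity_2d_pt_mult; [apply continuity_2d_pt_const |].
      apply (continuity_1d_2d_pt_comp atan).
      * eapply is_derive_continuity_pt, is_derive_atan.
      * apply continuity_2d_pt_mult; [apply H |]. apply continuity_2d_pt_inv; [| lra].
        apply continuity_2d_pt_plus; [exact M | apply H].
Qed.

(** Differentiation of the modulus and of the half-angle form of the argument, which holds
    near x because the slit plane is open. *)
Lemma is_Cderive_Cln f x l :
  is_Cderive f x l -> slit (f x) -> is_Cderive (fun t => Cln (f t)) x (l * / f x)%C.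
Proof.
  intros D S. generalize (slit_half_angle _ S) (slit_neq0 _ S); intros P N.
  generalize (proj1 (Cmod_gt_0 _) N) (Cmod2_alt (f x)) (Cnorm2_pos _ N); intros Pm E2 Pn.
  assert (L : locally x (fun t => slit (f t))).
  { destruct (slit_open (fun _ t => f t) 0 x) as [d Hd].
    - apply Ccont2_snd. eapply is_Cderive_cont, D.
    - exact S.
    - exists d; intros t Ht. apply (Hd 0 t); [| exact Ht]. rewrite Rminus_eq_0, Rabs_R0. apply d. }
  destruct D as [D1 D2].
  assert (DM : is_derive (fun t => Cmod (f t)) x ((Re (f x) * Re l + Im (f x) * Im l) / Cmod (f x))).
  { eapply is_derive_value.
    - apply (is_derive_sqrt (fun t => Re (f t) ^ 2 + Im (f t) ^ 2)).
      + apply (is_derive_plus (fun t => Re (f t) ^ 2) (fun t => Im (f t) ^ 2)).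
        * apply (is_derive_pow (fun t => Re (f t)) 2 x _ D1).
        * apply (is_derive_pow (fun t => Im (f t)) 2 x _ D2).
      + exact Pn.
    - change (sqrt (Re (f x) ^ 2 + Im (f x) ^ 2)) with (Cmod (f x)). unfold plus; simpl. field. lra. }
  assert (Einv : (l * / f x)%C = ((Re l * Re (f x) + Im l * Im (f x)) / Cmod (f x) ^ 2,
                                  (Im l * Re (f x) - Re l * Im (f x)) / Cmod (f x) ^ 2)).
  { rewrite E2. unfold Cmult, Cinv, Re, Im in *; simpl in *. f_equal; field; lra. }
  rewrite Einv. split; simpl.
  - eapply is_derive_value.
    + apply (is_derive_comp ln (fun t => Cmod (f t))); [apply is_derive_ln, Pm | exact DM].
    + unfold scal; simpl; unfold mult; simpl. field. lra.
  - apply is_derive_ext_loc with (fun t => 2 * atan (Im (f t) * / (Cmod (f t) + Re (f t)))).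
    { revert L. apply filter_imp. intros t Ht. symmetry. apply Carg_atan, Ht. }
    eapply is_derive_value.
    + apply (is_derive_scal (fun t => atan (Im (f t) * / (Cmod (f t) + Re (f t)))) x 2).
      apply (is_derive_comp atan (fun t => Im (f t) * / (Cmod (f t) + Re (f t)))); [apply is_derive_atan |].
      apply is_derive_Rmult; [exact D2 |].
      apply (is_derive_inv (fun t => Cmod (f t) + Re (f t))); [| lra].
      apply (is_derive_plus (fun t => Cmod (f t)) (fun t => Re (f t))); [exact DM | exact D1].
    + unfold scal, plus, Rsqr; simpl; unfold mult; simpl.
      revert P Pm E2. generalize (Cmod (f x)) (Re (f x)) (Im (f x)) (Re l) (Im l).
      intros r X Y p q P Pm E2.
      assert (E3 : (r + X) ^ 2 + Y ^ 2 = 2 * r * (r + X)) by nra.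
      assert (E4 : 1 + Y * / (r + X) * (Y * / (r + X)) = 2 * r / (r + X)).
      { transitivity (((r + X) ^ 2 + Y ^ 2) / (r + X) ^ 2); [field; lra |]. rewrite E3. field. lra. }
      rewrite E4. 
      transitivity ((q * r * (r + X) - Y * (X * p + Y * q) - Y * p * r) / (r * r * (r + X))).
      * field. lra.
      * replace (Y * (X * p + Y * q)) with (Y * X * p + (r ^ 2 - X ^ 2) * q) by (replace (r ^ 2 - X ^ 2) with (Y ^ 2) by lra; ring).
        field. lra.
Qed.

(** * The Lambert function *)

Lemma is_Cderive_ray W z t l :
  @is_derive C_AbsRing C_NormedModule W (RtoC t * z)%C l ->
  is_Cderive (fun t => W (RtoC t * z)%C) t (l * z)%C.
Proof.
  intros [_ H]. specialize (H _ (fun P HP => HP)).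
  assert (G : forall eps, 0 < eps -> exists d, 0 < d /\ forall h, Rabs h < d ->
     Cmod (W (RtoC (t + h) * z)%C - W (RtoC t * z)%C - RtoC h * (l * z))%C <= eps * Rabs h).
  { intros eps Heps. generalize (Cmod_ge_0 z); intros Pz.
    assert (Pe : 0 < eps / (Cmod z + 1)) by (apply Rdiv_lt_0_compat; lra).
    destruct (H (mkposreal _ Pe)) as [d Hd]. simpl in Hd.
    exists (d / (Cmod z + 1)). split; [apply Rdiv_lt_0_compat; [apply cond_pos | lra] |].
    intros h Hh.
    assert (Ed : (RtoC (t + h) * z - RtoC t * z)%C = (RtoC h * z)%C) by (rewrite RtoC_plus; ring).
    assert (Mh : Cmod (RtoC h * z) = Rabs h * Cmod z) by (rewrite Cmod_mult, Cmod_R; reflexivity).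
    specialize (Hd (RtoC (t + h) * z)%C).
    match type of Hd with ?A -> _ => assert (B : A) end.
    { change (Cmod (RtoC (t + h) * z - RtoC t * z)%C < d). rewrite Ed, Mh.
      assert (Rabs h * (Cmod z + 1) < d).
      { apply Rlt_le_trans with (d / (Cmod z + 1) * (Cmod z + 1)); [apply Rmult_lt_compat_r; lra | right; field; lra]. }
      generalize (Rabs_pos h). lra. }
    specialize (Hd B).
    change (Cmod (W (RtoC (t + h) * z) - W (RtoC t * z) - (RtoC (t + h) * z - RtoC t * z) * l)%C
       <= eps / (Cmod z + 1) * Cmod (RtoC (t + h) * z - RtoC t * z)%C) in Hd.
    rewrite Ed, Mh in Hd.
    replace (RtoC h * (l * z))%C with (RtoC h * z * l)%C by ring.
    eapply Rle_trans; [exact Hd |].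
    apply Rle_trans with (eps * Rabs h * (Cmod z / (Cmod z + 1))); [right; field; lra |].
    rewrite <- (Rmult_1_r (eps * Rabs h)) at 2. apply Rmult_le_compat_l.
    - apply Rmult_le_pos; [lra | apply Rabs_pos].
    - apply Rmult_le_reg_r with (Cmod z + 1); [lra |]. unfold Rdiv. rewrite Rmult_assoc, Rinv_l; lra. }
  assert (K : forall (g : R -> R) m, (forall h, Rabs (g (t + h) - g t - h * m) <=
      Cmod (W (RtoC (t + h) * z)%C - W (RtoC t * z)%C - RtoC h * (l * z))%C) -> is_derive g t m).
  { intros g m Hg. apply is_derive_Reals. intros eps Heps.
    destruct (G (eps / 2) ltac:(lra)) as [d [Pd Hd]]. exists (mkposreal _ Pd). intros h Hh0 Hh. simpl in Hh.
    assert (Ph : 0 < Rabs h) by (apply Rabs_pos_lt, Hh0).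
    replace ((g (t + h) - g t) / h - m) with ((g (t + h) - g t - h * m) / h) by (field; exact Hh0).
    rewrite Rabs_div by exact Hh0. apply Rmult_lt_reg_r with (Rabs h); [exact Ph |].
    unfold Rdiv. rewrite Rmult_assoc, Rinv_l by lra. rewrite Rmult_1_r.
    eapply Rle_lt_trans; [apply Hg |]. eapply Rle_lt_trans; [apply Hd, Hh |]. nra. }
  split; apply K; intros h.
  - eapply Rle_trans; [| apply re_le_Cmod]. right; f_equal. simpl; unfold Re; simpl; ring.
  - eapply Rle_trans; [| apply im_le_Cmod]. right; f_equal. simpl; unfold Im; simpl; ring.
Qed.

Lemma slit_in_domain z t : slit z -> 0 <= t -> LambertW_domain (RtoC t * z)%C.
Proof.
  intros Hz Ht [H1 H2].
  assert (P : 0 < 1 / exp 1) by (apply Rdiv_lt_0_compat; [lra | apply exp_pos]).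
  replace (Im (RtoC t * z)%C) with (t * Im z) in H1 by (simpl; unfold Im; ring).
  replace (Re (RtoC t * z)%C) with (t * Re z) in H2 by (simpl; unfold Re; ring).
  destruct Ht as [Ht| <-]; [| lra].
  destruct Hz as [H|H]; [| nra].
  apply Rmult_integral in H1; destruct H1; lra.
Qed.

Lemma Carg_slit z : z <> RtoC 0 -> Rabs (Carg z) < PI -> slit z.
Proof.
  intros N H. destruct (Req_dec (Im z) 0) as [E|E]; [| left; exact E].
  right. destruct (Rlt_le_dec 0 (Re z)) as [L|L]; [exact L | exfalso].
  assert (R0 : Re z <> 0) by (intros R0; apply N; apply injective_projections; assumption).
  assert (M : Cmod z = - Re z).
  { unfold Cmod. change (sqrt (Re z ^ 2 + Im z ^ 2) = - Re z). rewrite E.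
    replace (Re z ^ 2 + 0 ^ 2) with ((- Re z) ^ 2) by ring. apply sqrt_pow2. lra. }
  revert H. unfold Carg. rewrite M, E. destruct (Rlt_dec 0 0); [lra |].
  replace (Re z / - Re z) with (- (1)) by (field; lra).
  rewrite acos_opp, acos_1. rewrite Rminus_0_r, Rabs_right; generalize PI_RGT_0; lra.
Qed.

Lemma wexp_opp_W W z : is_LambertW W -> LambertW_domain z -> wexp (- W z)%C = (- z)%C.
Proof.
  intros [_ [HW _]] Hz. unfold wexp. replace (- - W z)%C with (W z) by ring.
  rewrite <- (HW z Hz) at 3. ring.
Qed.

Lemma W_ray_derive W z t :
  is_LambertW W -> slit z -> 0 <= t ->
  exists l, is_Cderive (fun t => W (RtoC t * z)%C) t l.
Proof.
  intros [HW _] Hz Ht. destruct (HW _ (slit_in_domain z t Hz Ht)) as [l Hl].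
  exists (l * z)%C. apply is_Cderive_ray, Hl.
Qed.

(** A continuity argument along t -> - W(t z), from 0 to - W z. At a first point outside Omega
    the path would be on the curve, where w e^(- w) is positive, but the value of that map
    on the path is - t z. The lines |Im w| = pi cannot be reached before the curve, as
    y cot y tends to minus infinity there. *)
Lemma W_range W z : is_LambertW W -> slit z -> Omega (- W z)%C.
Proof.
  intros HW Hz. generalize PI_RGT_0; intros Ppi.
  set (x := fun t => - Re (W (RtoC (clamp 0 1 t) * z)%C)).
  set (y := fun t => - Im (W (RtoC (clamp 0 1 t) * z)%C)).
  assert (Cl : forall t, continuity_pt (clamp 0 1) t).
  { intros t. apply continuity_pt_locally. intros eps. exists eps; intros u Hu.
    eapply Rle_lt_trans; [apply clamp_lipschitz | exact Hu]. }
  assert (Cxy : forall t, continuity_pt x t /\ continuity_pt y t).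
  { intros t. generalize (clamp_range 0 1 t Rle_0_1); intros R.
    destruct (W_ray_derive W z (clamp 0 1 t) HW Hz ltac:(lra)) as [l D].
    apply is_Cderive_cont in D. destruct D as [D1 D2].
    split; apply continuity_pt_opp.
    - apply (continuity_pt_comp (clamp 0 1) (fun t => Re (W (RtoC t * z)%C))); [apply Cl | exact D1].
    - apply (continuity_pt_comp (clamp 0 1) (fun t => Im (W (RtoC t * z)%C))); [apply Cl | exact D2]. }
  set (p := fun t => PI - Rabs (y t)).
  set (q := fun t => cos (y t) - x t * sinc (y t)).
  (* m is twice the minimum of p and q, so it is positive exactly when the point is in
     Omega; q has the sign of xcot (y t) - x t and is defined without division. *)
  set (m := fun t => p t + q t - Rabs (p t - q t)).
  assert (Cm : continuity m).
  { intros t. destruct (Cxy t) as [Cx Cy].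
    assert (Cp : continuity_pt p t).
    { apply continuity_pt_minus; [apply continuity_pt_const; intros ? ?; reflexivity |].
      apply (continuity_pt_comp y Rabs); [exact Cy | apply Rcontinuity_abs]. }
    assert (Cq : continuity_pt q t).
    { apply continuity_pt_minus.
      - apply (continuity_pt_comp y cos); [exact Cy | apply continuity_cos].
      - apply continuity_pt_mult; [exact Cx |]. apply (continuity_pt_comp y sinc); [exact Cy | apply sinc_cont]. }
    apply continuity_pt_minus; [apply continuity_pt_plus; assumption |].
    apply (continuity_pt_comp (fun t => p t - q t) Rabs); [apply continuity_pt_minus; assumption | apply Rcontinuity_abs]. }
  assert (M0 : 0 < m 0).
  { assert (x 0 = 0 /\ y 0 = 0) as [X0 Y0].
    { unfold x, y. rewrite clamp_id by lra. replace (RtoC 0 * z)%C with (RtoC 0) by ring.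
      destruct HW as (_ & _ & ->). simpl. lra. }
    unfold m, p, q. rewrite X0, Y0, Rabs_R0, cos_0. unfold Rabs; destruct Rcase_abs; lra. }
  assert (E1 : y 1 = Im (- W z)%C /\ x 1 = Re (- W z)%C).
  { unfold x, y. rewrite clamp_id by lra. replace (RtoC 1 * z)%C with z by ring. split; reflexivity. }
  destruct E1 as [Ey Ex].
  destruct (Rlt_le_dec 0 (m 1)) as [L|L].
  - assert (0 < p 1 /\ 0 < q 1) as [P1 Q1].
    { unfold m, Rabs in L. destruct Rcase_abs in L; lra. }
    unfold p, q in *. rewrite Ey, Ex in *.
    assert (A : Rabs (Im (- W z)%C) < PI) by lra. split; [exact A |].
    generalize (sinc_pos _ A); intros S. unfold xcot.
    apply Rmult_lt_reg_r with (sinc (Im (- W z)%C)); [exact S |].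
    unfold Rdiv. rewrite Rmult_assoc, Rinv_l; lra.
  - exfalso. destruct (IVT_gen m 0 1 0 Cm) as [t [Ht Mt]].
    { rewrite Rmin_right, Rmax_left by lra. lra. }
    rewrite Rmin_left, Rmax_right in Ht by lra.
    assert (t <> 0) by (intros ->; lra).
    assert (Hpq : 0 <= p t /\ 0 <= q t /\ (p t = 0 \/ q t = 0)).
    { unfold m, Rabs in Mt. destruct Rcase_abs in Mt; lra. }
    destruct Hpq as (Hp & Hq & H0).
    assert (A : Rabs (y t) < PI).
    { destruct (Req_dec (Rabs (y t)) PI) as [A|A]; [| unfold p in Hp; lra].
      destruct (sinc_at_PI _ A) as [S C]. unfold q in Hq. rewrite S, C in Hq. lra. }
    assert (Q0 : q t = 0) by (unfold p in H0; lra).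
    generalize (sinc_pos _ A); intros S.
    assert (X : x t = xcot (y t)).
    { unfold q in Q0. unfold xcot. apply Rmult_eq_reg_r with (sinc (y t)); [| lra].
      unfold Rdiv. rewrite Rmult_assoc, Rinv_l; lra. }
    assert (B : wexp (x t, y t) = (- (RtoC t * z))%C).
    { rewrite <- (wexp_opp_W W (RtoC t * z)%C HW (slit_in_domain z t Hz (proj1 Ht))).
      f_equal. unfold x, y. rewrite clamp_id by lra. reflexivity. }
    rewrite X, wexp_boundary in B by exact A.
    assert (Pos : 0 < exp (- xcot (y t)) / sinc (y t)).
    { apply Rdiv_lt_0_compat; [apply exp_pos | exact S]. }
    assert (F : (RtoC t * z)%C = (- RtoC (exp (- xcot (y t)) / sinc (y t)))%C) by (rewrite B; ring).
    generalize (slit_scal t z ltac:(lra) Hz). rewrite F. intros [G|G]; simpl in G; lra.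
Qed.

(** Logarithmic differentiation of W e^W = t z. *)
Lemma W_ray_ode W z s l :
  is_LambertW W -> slit z -> 0 < s -> is_Cderive (fun t => W (RtoC t * z)%C) s l ->
  (RtoC s * l * (RtoC 1 + W (RtoC s * z)))%C = W (RtoC s * z)%C.
Proof.
  intros HW Hz Hs D. set (b := W (RtoC s * z)%C).
  assert (D1 : is_Cderive (fun t => RtoC t * z)%C s (l * Cexp b + b * (l * Cexp b))%C).
  { apply is_Cderive_ext_loc with (fun t => W (RtoC t * z) * Cexp (W (RtoC t * z)))%C.
    - exists (mkposreal _ Hs). intros t Ht. apply HW, slit_in_domain; [exact Hz |].
      change (Rabs (t - s) < s) in Ht. apply Rabs_def2 in Ht. lra.
    - apply (is_Cderive_mult (fun t => W (RtoC t * z)%C)); [exact D |].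
      apply (is_Cderive_exp (fun t => W (RtoC t * z)%C)), D. }
  assert (D2 : is_Cderive (fun t => RtoC t * z)%C s (RtoC 1 * z + RtoC s * RtoC 0)%C).
  { apply (is_Cderive_mult (fun t => RtoC t)); [apply is_Cderive_id | apply is_Cderive_const]. }
  assert (E := is_Cderive_unique _ _ _ _ D1 D2).
  assert (I : (b * Cexp b)%C = (RtoC s * z)%C) by (apply HW, slit_in_domain; [exact Hz | lra]).
  assert (F : (RtoC s * l * (RtoC 1 + b) * Cexp b)%C = (b * Cexp b)%C).
  { rewrite I. transitivity (RtoC s * (l * Cexp b + b * (l * Cexp b)))%C; [ring |]. rewrite E. ring. }
  transitivity (RtoC s * l * (RtoC 1 + b) * (Cexp b * Cexp (- b)))%C; [rewrite Cexp_opp_r; ring |].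
  transitivity (RtoC s * l * (RtoC 1 + b) * Cexp b * Cexp (- b))%C; [ring |].
  rewrite F. transitivity (b * (Cexp b * Cexp (- b)))%C; [ring |]. rewrite Cexp_opp_r. ring.
Qed.

Lemma slit_ray s z r : 0 <= s -> 0 <= r -> slit z -> slit (RtoC 1 + RtoC s * z * RtoC r)%C.
Proof.
  intros Hs Hr Hz. replace (RtoC 1 + RtoC s * z * RtoC r)%C with (RtoC 1 + z * RtoC (s * r))%C by (rewrite RtoC_mult; ring).
  apply slit_one_plus; [apply Rmult_le_pos; assumption | exact Hz].
Qed.

Lemma Ccont2_ray z s v : Ccont2 (fun s v => RtoC 1 + RtoC s * z * RtoC (phi_ext v))%C s v.
Proof.
  apply Ccont2_plus; [apply Ccont2_const |]. apply Ccont2_mult; [| apply Ccont2_phi_ext].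
  apply Ccont2_mult; [apply Ccont2_fst | apply Ccont2_const].
Qed.

(** Along the ray t z both sides have the same derivative for 0 < t < 1, by
    [resolvent_integral] and [W_ray_ode], and both vanish at t = 0. *)
Lemma W_eq_log_integral W z :
  is_LambertW W -> slit z ->
  CInt (fun v => Cln (RtoC 1 + z * RtoC (phi_ext v)))%C 0 PI = (RtoC PI * W z)%C.
Proof.
  intros HW Hz. generalize PI_RGT_0; intros Ppi.
  set (K := fun s v => Cln (RtoC 1 + RtoC s * z * RtoC (phi_ext v))%C).
  set (D := fun s v => (z * RtoC (phi_ext v) * / (RtoC 1 + RtoC s * z * RtoC (phi_ext v)))%C).
  assert (CK : forall s v, 0 <= s <= 1 -> 0 <= v <= PI -> Ccont2 K s v).
  { intros s v Hs Hv. apply (Ccont2_Cln (fun s v => RtoC 1 + RtoC s * z * RtoC (phi_ext v))%C); [apply Ccont2_ray |].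
    apply slit_ray; [lra | apply phi_ext_nonneg | exact Hz]. }
  assert (CD : forall s v, 0 <= s -> Ccont2 D s v).
  { intros s v Hs. apply Ccont2_mult.
    - apply Ccont2_mult; [apply Ccont2_const | apply Ccont2_phi_ext].
    - apply (Ccont2_inv (fun s v => RtoC 1 + RtoC s * z * RtoC (phi_ext v))%C); [apply Ccont2_ray |].
      apply slit_neq0, slit_ray; [exact Hs | apply phi_ext_nonneg | exact Hz]. }
  assert (DK : forall s v, 0 < s -> is_Cderive (fun t => K t v) s (D s v)).
  { intros s v Hs. unfold K, D.
    apply (is_Cderive_Cln (fun t => RtoC 1 + RtoC t * z * RtoC (phi_ext v))%C).
    - eapply is_Cderive_value.
      + apply is_Cderive_plus; [apply is_Cderive_const |].
        apply (is_Cderive_mult (fun t => RtoC t * z)%C); [| apply is_Cderive_const].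
        apply (is_Cderive_mult (fun t => RtoC t)); [apply is_Cderive_id | apply is_Cderive_const].
      + cbv beta. ring.
    - apply slit_ray; [lra | apply phi_ext_nonneg | exact Hz]. }
  set (u := fun t => (CInt (K (clamp 0 1 t)) 0 PI - RtoC PI * W (RtoC t * z))%C).
  assert (U : u 0 = u 1).
  { apply Ceq_of_derive_zero; [lra | |].
    - intros s Hs. destruct (W_ray_derive W z s HW Hz ltac:(lra)) as [l Hl].
      eapply is_Cderive_value.
      + unfold u. apply is_Cderive_minus.
        * apply (CInt_param_derive K D 0 1 0 PI s); try lra; try assumption.
          -- intros s' v Hs' Hv. exists (mkposreal s' (proj1 Hs')). intros t w Ht _. apply DK.
             simpl in Ht. apply Rabs_def2 in Ht. lra.
          -- intros; apply CD; lra.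
        * apply (is_Cderive_mult (fun _ => RtoC PI)); [apply is_Cderive_const | exact Hl].
      + set (b := W (RtoC s * z)%C).
        assert (O : Omega (- b)%C) by (apply W_range; [exact HW | apply slit_scal; [lra | exact Hz]]).
        assert (Ew : wexp (- b)%C = (- (RtoC s * z))%C) by (apply wexp_opp_W; [exact HW | apply slit_in_domain; [exact Hz | lra]]).
        assert (Sl : slit (- wexp (- b))%C).
        { rewrite Ew. replace (- - (RtoC s * z))%C with (RtoC s * z)%C by ring. apply slit_scal; [lra | exact Hz]. }
        assert (N1 := Omega_neq1 _ O).
        assert (R := resolvent_integral _ O Sl).
        set (k := (/ (RtoC 1 - - b))%C) in *.
        assert (Ns : RtoC s <> RtoC 0) by (intros F; apply RtoC_inj in F; lra).
        assert (SD : (RtoC s * CInt (D s) 0 PI)%C = (RtoC PI * (RtoC 1 - k))%C).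
        { rewrite <- CInt_scal; [| lra | intros; apply (Ccont2_slice D), CD; lra].
          transitivity (CInt (fun v => (RtoC 1 - k) - (/ (RtoC 1 - wexp (- b) * RtoC (phi_ext v)) - k))%C 0 PI).
          - apply CInt_ext; [lra |]. intros v Hv. unfold D. rewrite Ew.
            replace (RtoC 1 - - (RtoC s * z) * RtoC (phi_ext v))%C with (RtoC 1 + RtoC s * z * RtoC (phi_ext v))%C by ring.
            generalize (slit_neq0 _ (slit_ray s z (phi_ext v) ltac:(lra) (phi_ext_nonneg v) Hz)).
            generalize k. intros k0 Hne. field. exact Hne.
          - rewrite CInt_minus; [| lra | | intros; apply Ccont_resolvent, Sl].
            + rewrite R, CInt_const. replace (PI - 0) with PI by ring. ring.
            + intros v _. apply (Ccont2_slice (fun _ _ => RtoC 1 - k)%C 0 v), Ccont2_const. }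
        assert (SL : (RtoC s * l)%C = (RtoC 1 - k)%C).
        { assert (O2 := W_ray_ode W z s l HW Hz ltac:(lra) Hl). fold b in O2.
          replace (RtoC 1 - - b)%C with (RtoC 1 + b)%C in N1 by ring.
          transitivity (RtoC s * l * (RtoC 1 + b) * / (RtoC 1 + b))%C; [field; exact N1 |].
          rewrite O2. unfold k. replace (RtoC 1 - - b)%C with (RtoC 1 + b)%C by ring. field. exact N1. }
        assert (SD2 : CInt (D s) 0 PI = (RtoC PI * l)%C).
        { transitivity (/ RtoC s * (RtoC s * CInt (D s) 0 PI))%C; [field; exact Ns |].
          rewrite SD, <- SL. field. exact Ns. }
        rewrite SD2. ring.
    - intros s Hs. destruct (W_ray_derive W z s HW Hz ltac:(lra)) as [l Hl].
      apply (Ccont2_slice (fun _ t => u t) 0 s). apply Ccont2_minus.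
      + apply Ccont2_snd, CInt_param_clamp_cont; try lra. exact CK.
      + apply Ccont2_mult; [apply Ccont2_const |]. apply (Ccont2_snd (fun t => W (RtoC t * z)%C)).
        eapply is_Cderive_cont, Hl. }
  unfold u in U. rewrite !clamp_id in U by lra.
  replace (RtoC 1 * z)%C with z in U by ring.
  replace (RtoC 0 * z)%C with (RtoC 0) in U by ring.
  rewrite (proj2 (proj2 HW)) in U.
  rewrite (CInt_ext (K 0) (fun _ => RtoC 0) 0 PI), CInt_const in U; [| lra |].
  - rewrite (CInt_ext _ (K 1) 0 PI); [| lra |].
    + transitivity (CInt (K 1) 0 PI - RtoC PI * W z + RtoC PI * W z)%C; [ring |].
      rewrite <- U. ring.
    + intros v _. unfold K. replace (RtoC 1 * z)%C with z by ring. reflexivity.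
  - intros v _. unfold K. replace (RtoC 1 + RtoC 0 * z * RtoC (phi_ext v))%C with (RtoC 1) by ring.
    assert (S1 : slit (RtoC 1)) by (right; simpl; lra).
    unfold Cln. rewrite (Carg_atan _ S1), Cmod_1, ln_1. simpl.
    unfold RtoC. f_equal. unfold Rdiv. rewrite Rmult_0_l, atan_0. ring.
Qed.

Theorem theorem6p2 :
  forall W : C -> C, is_LambertW W ->
  forall z : C, z <> RtoC 0 -> Rabs (Carg z) < PI ->
    @ex_RInt C_R_NormedModule (LambertW_integrand z) 0 PI /\
    W z = (RtoC (1 / PI) *
           @RInt C_R_CompleteNormedModule (LambertW_integrand z) 0 PI)%C.
Proof.
  intros W HW z Hz0 Harg. generalize PI_RGT_0; intros Ppi.
  assert (Hz := Carg_slit z Hz0 Harg).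
  set (f := fun v => Cln (RtoC 1 + z * RtoC (phi_ext v))%C).
  assert (Cf : forall v, Ccont f v).
  { intros v. apply (Ccont2_slice (fun _ v => f v) 0 v).
    apply (Ccont2_Cln (fun _ v => RtoC 1 + z * RtoC (phi_ext v))%C).
    - apply Ccont2_plus; [apply Ccont2_const |].
      apply Ccont2_mult; [apply Ccont2_const | apply Ccont2_phi_ext].
    - apply slit_one_plus; [apply phi_ext_nonneg | exact Hz]. }
  assert (I : @is_RInt C_R_NormedModule (LambertW_integrand z) 0 PI (CInt f 0 PI)).
  { apply is_RInt_ext with f.
    - rewrite Rmin_left, Rmax_right by lra. intros v Hv.
      unfold f, LambertW_integrand. rewrite phi_ext_eq by (apply Rabs_def1; lra).
      assert (Sv : 0 < sin v) by (apply sin_gt_0; lra).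
      assert (E : sinc v = sin v / v) by (rewrite sin_eq_sinc; field; lra).
      unfold phi, xcot, cot. rewrite E.
      replace (cos v / (sin v / v)) with (v * (cos v / sin v)) by (field; lra). reflexivity.
    - destruct (Ccont_ex_RInt f 0 PI ltac:(lra) ltac:(intros; apply Cf)) as [F1 F2].
      apply (@is_RInt_fct_extend_pair R_NormedModule R_NormedModule f);
      apply (@RInt_correct R_CompleteNormedModule); assumption. }
  split; [exists (CInt f 0 PI); exact I |].
  rewrite (@is_RInt_unique C_R_CompleteNormedModule _ _ _ _ I).
  unfold f. rewrite (W_eq_log_integral W z HW Hz).
  assert (Np : RtoC PI <> RtoC 0) by (intros F; apply RtoC_inj in F; lra).
  rewrite RtoC_div by lra. field. exact Np.
Qed.
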